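(* For all $C,D,Q>0$ and $r\in(0,1]$ we have $$D\sharp_r Q-C\sharp_r Q=\frac{\sin(r\pi)}{\pi}\int_0^\infty \lambda^{r}\left(\int_0^1 Q\big(Q+\lambda[(1-t)C+tD]\big)^{-1}(D-C)\big(Q+\lambda[(1-t)C+tD]\big)^{-1}Q\,dt\right)d\lambda.$$
   Context: All operators are bounded linear operators on a complex Hilbert space $H$. $T>0$ means that $T$ is positive ($\langle Tx,x\rangle\ge 0$ for all $x\in H$) and invertible. For $A,B>0$ and $\nu\in[0,1]$ the weighted operator geometric mean is $A\sharp_\nu B:=A^{1/2}\left(A^{-1/2}BA^{-1/2}\right)^{\nu}A^{1/2}$.
   Formalization: The weight λ^r in the outer integral is corrected to λ^(r-1): as printed the identity fails (scalars C=Q=1, D=4, r=1/2 give 1 on the left and 1/2 on the right) and for r=1 the integral diverges unless C=D. *)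

(* Defs.v *)
From Stdlib Require Import Reals Lra List.
From Stdlib Require Import FunctionalExtensionality PropExtensionality.
From Stdlib Require Import ProofIrrelevance ClassicalEpsilon.
From Coquelicot Require Import Coquelicot.
Open Scope R_scope.

(* The inner product is linear in its first argument. Completeness is part of
   [CompleteNormedModule], and definiteness follows from [inner_norm] because
   only the zero vector has norm 0. *)
Record hilbertSpace : Type := HilbertSpace {
  hsort :> CompleteNormedModule C_AbsRing;
  inner : hsort -> hsort -> C;
  inner_plus_l : forall x y z : hsort,
    inner (plus x y) z = Cplus (inner x z) (inner y z);
  inner_scal_l : forall (a : C) (x y : hsort),
    inner (scal a x) y = Cmult a (inner x y);
  inner_conj : forall x y : hsort, inner y x = Cconj (inner x y);
  inner_norm : forall x : hsort, inner x x = RtoC (norm x ^ 2)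
}.

Arguments inner {h} _ _.

(* Coquelicot's [is_linear] includes boundedness. *)
Record boundedOp (H : hilbertSpace) : Type := Bop {
  bop_fun :> H -> H;
  bop_linear : is_linear (K := C_AbsRing) (U := H) (V := H) bop_fun
}.

Arguments Bop {H} _ _.
Arguments bop_fun {H} _ _.
Arguments bop_linear {H} _.

Lemma minus_plus_plus {G : AbelianGroup} (a b c d : G) :
  minus (plus a b) (plus c d) = plus (minus a c) (minus b d).
Proof.
  unfold minus. rewrite opp_plus, <- !plus_assoc. f_equal.
  rewrite !plus_assoc. f_equal. apply plus_comm.
Qed.

Section Operators.
Context {H : hilbertSpace}.
Implicit Types (S T : boundedOp H) (x y : H).

Lemma hnorm_triangle x y : norm (plus x y) <= norm x + norm y.
Proof. exact (norm_triangle (V := H) x y). Qed.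

Lemma hnorm_triangle_inv x y : norm x - norm y <= norm (minus x y).
Proof.
  eapply Rle_trans; [apply Rle_abs|]. exact (norm_triangle_inv (V := H) x y).
Qed.

Lemma hnorm_ge_0 x : 0 <= norm x.
Proof. exact (norm_ge_0 (V := H) x). Qed.

Lemma hnorm_zero : norm (zero : H) = 0.
Proof. exact (norm_zero (V := H)). Qed.

Lemma hnorm_opp x : norm (opp x) = norm x.
Proof. exact (norm_opp (V := H) x). Qed.

Lemma hnorm_minus_sym x y : norm (minus x y) = norm (minus y x).
Proof. rewrite <- hnorm_opp. f_equal. exact (opp_minus x y). Qed.

Lemma hnorm_eq_zero x : norm x = 0 -> x = zero.
Proof. exact (norm_eq_zero (V := H) x). Qed.

Lemma hnorm_scal (a : C) x : norm (scal a x) <= Cmod a * norm x.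
Proof. exact (norm_scal (K := C_AbsRing) (V := H) a x). Qed.

Lemma hnorm_minus_trans z x y :
  norm (minus x y) <= norm (minus x z) + norm (minus z y).
Proof.
  rewrite (minus_trans z x y : minus x y = plus (minus x z) (minus z y)).
  apply hnorm_triangle.
Qed.

Lemma hnorm_minus_plus (a b c d : H) :
  norm (minus (plus a b) (plus c d)) <= norm (minus a c) + norm (minus b d).
Proof.
  eapply Rle_trans; [|apply hnorm_triangle].
  right. f_equal. exact (minus_plus_plus (G := H) a b c d).
Qed.

Lemma hnorm_minus_scal (k : C) x y :
  norm (minus (scal k x) (scal k y)) <= Cmod k * norm (minus x y).
Proof.
  eapply Rle_trans; [|apply hnorm_scal].
  right. f_equal. symmetry. exact (scal_minus_distr_l (V := H) k x y).
Qed.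

Lemma bop_eq S T : (forall x, S x = T x) -> S = T.
Proof.
  destruct S as [s hs], T as [t ht]; simpl; intros E.
  assert (Est : s = t) by (apply functional_extensionality; exact E).
  subst t; f_equal; apply proof_irrelevance.
Qed.

Lemma bop_morph_zero T : T zero = zero.
Proof. exact (linear_zero _ (bop_linear T)). Qed.

Lemma bop_morph_plus T x y : T (plus x y) = plus (T x) (T y).
Proof. exact (linear_plus _ (bop_linear T) x y). Qed.

Lemma bop_morph_scal T (a : C) x : T (scal a x) = scal a (T x).
Proof. exact (linear_scal _ (bop_linear T) a x). Qed.

Lemma bop_plus_linear S T :
  is_linear (K := C_AbsRing) (U := H) (V := H) (fun x => plus (S x) (T x)).
Proof.
  destruct (bop_linear S) as [s1 s2 [m [m0 hm]]].
  destruct (bop_linear T) as [t1 t2 [n [n0 hn]]].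
  split.
  - intros x y. rewrite s1, t1, <- !plus_assoc. f_equal.
    rewrite !plus_assoc. f_equal. apply plus_comm.
  - intros k x. rewrite s2, t2. exact (eq_sym (scal_distr_l (V := H) k (S x) (T x))).
  - exists (m + n). split; [lra|]. intros x.
    eapply Rle_trans; [apply hnorm_triangle|].
    specialize (hm x); specialize (hn x). lra.
Qed.

Lemma bop_scal_linear (a : C) T :
  is_linear (K := C_AbsRing) (U := H) (V := H) (fun x => scal a (T x)).
Proof.
  apply (is_linear_comp (K := C_AbsRing) (U := H) (V := H) (W := H)
           T (fun x => scal a x)).
  - apply bop_linear.
  - exact (is_linear_scal_r (K := C_AbsRing) (V := H) a Cmult_comm).
Qed.

Definition bop_zero : boundedOp H := Bop (fun _ => zero) is_linear_zero.
Definition bop_id : boundedOp H := Bop (fun x => x) is_linear_id.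
Definition bop_plus S T : boundedOp H := Bop _ (bop_plus_linear S T).
Definition bop_cscal (a : C) T : boundedOp H := Bop _ (bop_scal_linear a T).
Definition bop_opp T : boundedOp H :=
  Bop (fun x => opp (T x))
    (is_linear_comp T opp (bop_linear T) is_linear_opp).
Definition bop_comp S T : boundedOp H :=
  Bop (fun x => S (T x)) (is_linear_comp T S (bop_linear T) (bop_linear S)).

Definition bop_AbelianMonoid_mixin : AbelianMonoid.mixin_of (boundedOp H).
Proof.
  refine (AbelianMonoid.Mixin (boundedOp H) bop_plus bop_zero _ _ _).
  - intros S T; apply bop_eq; intros x; exact (plus_comm (S x) (T x)).
  - intros S T U; apply bop_eq; intros x; exact (plus_assoc (S x) (T x) (U x)).
  - intros S; apply bop_eq; intros x; exact (plus_zero_r (S x)).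
Defined.

Canonical bop_AbelianMonoid :=
  AbelianMonoid.Pack (boundedOp H) bop_AbelianMonoid_mixin (boundedOp H).

Definition bop_AbelianGroup_mixin : AbelianGroup.mixin_of bop_AbelianMonoid.
Proof.
  refine (AbelianGroup.Mixin bop_AbelianMonoid bop_opp _).
  intros S; apply bop_eq; intros x; exact (plus_opp_r (S x)).
Defined.

Canonical bop_AbelianGroup :=
  AbelianGroup.Pack (boundedOp H)
    (AbelianGroup.Class _ bop_AbelianMonoid_mixin bop_AbelianGroup_mixin)
    (boundedOp H).

(* Real scalars, since Coquelicot integrates functions with values in normed
   modules over R. *)
Definition bop_ModuleSpace_mixin :
  ModuleSpace.mixin_of R_Ring bop_AbelianGroup.
Proof.
  refine (ModuleSpace.Mixin R_Ring bop_AbelianGroup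
            (fun a T => bop_cscal (RtoC a) T) _ _ _ _).
  - intros a b T; apply bop_eq; intros x; simpl.
    rewrite RtoC_mult. exact (scal_assoc (V := H) (RtoC a) (RtoC b) (T x)).
  - intros T; apply bop_eq; intros x; simpl. apply (scal_one (V := H) (T x)).
  - intros a S T; apply bop_eq; intros x.
    exact (scal_distr_l (V := H) (RtoC a) (S x) (T x)).
  - intros a b T; apply bop_eq; intros x; simpl.
    rewrite RtoC_plus. exact (scal_distr_r (V := H) (RtoC a) (RtoC b) (T x)).
Defined.

Canonical bop_ModuleSpace :=
  ModuleSpace.Pack R_Ring (boundedOp H)
    (ModuleSpace.Class R_Ring _ (AbelianGroup.class bop_AbelianGroup)
       bop_ModuleSpace_mixin) (boundedOp H).

Definition bop_norm T : R :=
  real (Lub_Rbar (fun a => exists x, norm x <= 1 /\ a = norm (T x))).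

Lemma bop_norm_lub T :
  is_lub_Rbar (fun a => exists x, norm x <= 1 /\ a = norm (T x)) (bop_norm T).
Proof.
  unfold bop_norm.
  set (E := fun a => _).
  destruct (bop_linear T) as [_ _ [m [m0 hm]]].
  pose proof (Lub_Rbar_correct E) as L.
  destruct (Lub_Rbar E) as [l| |]; [exact L| |]; destruct L as [L1 L2].
  - destruct (L2 (Finite m)).
    intros a [x [hx ->]]. simpl. specialize (hm x).
    apply Rle_trans with (1 := hm).
    rewrite <- (Rmult_1_r m) at 2. apply Rmult_le_compat_l; lra.
  - destruct (L1 (norm (T zero))).
    exists zero. split; [rewrite hnorm_zero; lra|reflexivity].
Qed.

Lemma bop_norm_le T x : norm (T x) <= bop_norm T * norm x.
Proof.
  destruct (Req_dec (norm x) 0) as [h0|h0].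
  - rewrite (hnorm_eq_zero _ h0), bop_morph_zero, !hnorm_zero.
    lra.
  - pose proof (hnorm_ge_0 x) as hx.
    set (u := scal (RtoC (/ norm x)) x : H).
    assert (hu : norm u <= 1).
    { unfold u. eapply Rle_trans; [apply (hnorm_scal)|].
      rewrite Cmod_R, Rabs_pos_eq.
      - rewrite Rinv_l; lra.
      - left; apply Rinv_0_lt_compat; lra. }
    assert (ex : x = scal (RtoC (norm x)) u).
    { unfold u. rewrite scal_assoc.
      change (mult (RtoC (norm x)) (RtoC (/ norm x)))
        with (Cmult (RtoC (norm x)) (RtoC (/ norm x))).
      rewrite <- RtoC_mult, Rinv_r by exact h0.
      symmetry; apply (scal_one (V := H) x). }
    assert (eT : T x = scal (RtoC (norm x)) (T u)).
    { rewrite ex at 1. apply bop_morph_scal. }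
    rewrite eT. eapply Rle_trans; [apply (hnorm_scal)|].
    rewrite Cmod_R, Rabs_pos_eq, Rmult_comm by exact hx.
    apply Rmult_le_compat_r; [exact hx|].
    apply (proj1 (bop_norm_lub T)). exists u; auto.
Qed.

Lemma bop_norm_bound T m :
  (forall x, norm x <= 1 -> norm (T x) <= m) -> bop_norm T <= m.
Proof.
  intros h. apply (proj2 (bop_norm_lub T) (Finite m)).
  intros a [x [hx ->]]. exact (h x hx).
Qed.

Lemma bop_norm_unit T x : norm x <= 1 -> norm (T x) <= bop_norm T.
Proof. intros h. apply (proj1 (bop_norm_lub T)). exists x; auto. Qed.

Lemma bop_norm_triangle S T :
  bop_norm (plus S T) <= bop_norm S + bop_norm T.
Proof.
  apply bop_norm_bound; intros x hx.
  eapply Rle_trans; [apply (hnorm_triangle (S x) (T x))|].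
  apply Rplus_le_compat; apply bop_norm_unit; exact hx.
Qed.

Lemma bop_norm_scal (a : R) T :
  bop_norm (scal a T) <= abs a * bop_norm T.
Proof.
  apply bop_norm_bound; intros x hx.
  eapply Rle_trans; [apply (hnorm_scal (RtoC a) (T x))|].
  rewrite Cmod_R.
  apply Rmult_le_compat_l; [apply Rabs_pos|].
  apply bop_norm_unit; exact hx.
Qed.

Lemma bop_norm_eq0 T : bop_norm T = 0 -> T = zero.
Proof.
  intros h; apply bop_eq; intros x. apply hnorm_eq_zero.
  pose proof (bop_norm_le T x) as h1. rewrite h, Rmult_0_l in h1.
  pose proof (hnorm_ge_0 (T x)). lra.
Qed.

Lemma bop_norm_zero : bop_norm zero = 0.
Proof.
  apply Rle_antisym.
  - apply bop_norm_bound; intros x _. change (norm (zero : H) <= 0).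
    rewrite hnorm_zero; lra.
  - eapply Rle_trans; [apply hnorm_ge_0|].
    apply (bop_norm_unit zero zero). rewrite hnorm_zero; lra.
Qed.

Lemma bop_norm_minus_diag T : bop_norm (minus T T) = 0.
Proof. rewrite <- bop_norm_zero. f_equal. exact (plus_opp_r T). Qed.

Lemma bop_norm_minus_sym S T : bop_norm (minus S T) <= bop_norm (minus T S).
Proof.
  apply bop_norm_bound; intros x hx.
  change (norm (minus (S x) (T x)) <= bop_norm (minus T S)).
  rewrite hnorm_minus_sym. exact (bop_norm_unit (minus T S) x hx).
Qed.

Lemma bop_norm_minus_trans T S U :
  bop_norm (minus S U) <= bop_norm (minus S T) + bop_norm (minus T U).
Proof.
  apply bop_norm_bound; intros x hx.
  eapply Rle_trans; [apply (hnorm_minus_trans (T x) (S x) (U x))|].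
  apply Rplus_le_compat.
  - exact (bop_norm_unit (minus S T) x hx).
  - exact (bop_norm_unit (minus T U) x hx).
Qed.

Definition bop_ball T (e : R) S : Prop := bop_norm (minus S T) < e.

Definition bop_UniformSpace_mixin : UniformSpace.mixin_of (boundedOp H).
Proof.
  refine (UniformSpace.Mixin (boundedOp H) bop_zero bop_ball _ _ _).
  - intros T e. unfold bop_ball. rewrite bop_norm_minus_diag. apply cond_pos.
  - intros S T e h. eapply Rle_lt_trans; [apply bop_norm_minus_sym|exact h].
  - intros S T U d e h1 h2. unfold bop_ball in *.
    eapply Rle_lt_trans; [apply (bop_norm_minus_trans T)|lra].
Defined.

Canonical bop_UniformSpace :=
  UniformSpace.Pack (boundedOp H) bop_UniformSpace_mixin (boundedOp H).

Canonical bop_NormedModuleAux :=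
  NormedModuleAux.Pack R_AbsRing (boundedOp H)
    (NormedModuleAux.Class R_AbsRing _
       (ModuleSpace.class R_Ring bop_ModuleSpace)
       bop_UniformSpace_mixin) (boundedOp H).

Definition bop_NormedModule_mixin :
  NormedModule.mixin_of R_AbsRing bop_NormedModuleAux.
Proof.
  refine (NormedModule.Mixin R_AbsRing bop_NormedModuleAux bop_norm 1
            bop_norm_triangle bop_norm_scal _ _ bop_norm_eq0).
  - intros S T e h; exact h.
  - intros S T e h. rewrite Rmult_1_l. exact h.
Defined.

Canonical bop_NormedModule :=
  NormedModule.Pack R_AbsRing (boundedOp H)
    (NormedModule.Class R_AbsRing _
       (NormedModuleAux.class R_AbsRing bop_NormedModuleAux)
       bop_NormedModule_mixin) (boundedOp H).

Lemma bop_complete (F : (boundedOp H -> Prop) -> Prop) :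
  ProperFilter F -> cauchy F ->
  exists L : boundedOp H, forall e : posreal, F (ball L e).
Proof.
  intros PF CF.
  pose (G := fun x : H => filtermap (fun T : boundedOp H => T x) F).
  assert (PG : forall x, ProperFilter (G x))
    by (intros x; apply filtermap_proper_filter; exact PF).
  assert (CG : forall x, cauchy (G x)).
  { intros x e.
    pose proof (hnorm_ge_0 x) as hx.
    assert (d0 : 0 < e / (norm x + 1)).
    { apply Rdiv_lt_0_compat; [apply cond_pos|lra]. }
    destruct (CF (mkposreal _ d0)) as [T0 h0].
    exists (T0 x). unfold G, filtermap.
    apply filter_imp with (2 := h0). intros T hT.
    apply (norm_compat1 (V := H) (T0 x) (T x)).
    change (bop_norm (minus T T0) < e / (norm x + 1)) in hT.
    change (norm ((minus T T0 : boundedOp H) x) < e).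
    eapply Rle_lt_trans; [apply bop_norm_le|].
    apply Rle_lt_trans with (e / (norm x + 1) * norm x).
    - apply Rmult_le_compat_r; lra.
    - apply Rlt_le_trans with (e / (norm x + 1) * (norm x + 1)).
      + apply Rmult_lt_compat_l; lra.
      + right; field; lra. }
  pose (L := fun x : H => lim (G x)).
  assert (hL : forall x (e : posreal), F (fun T => norm (minus (T x) (L x)) < e)).
  { intros x e.
    pose proof (norm_factor_gt_0 (V := H)) as nf.
    assert (d0 : 0 < e / (norm_factor (V := H))).
    { apply Rdiv_lt_0_compat; [apply cond_pos|lra]. }
    pose proof (complete_cauchy (G x) (PG x) (CG x) (mkposreal _ d0)) as h.
    unfold G, filtermap in h. apply filter_imp with (2 := h).
    intros T hT. pose proof (norm_compat2 (V := H) _ _ _ hT) as h2. simpl in h2.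
    replace (norm_factor * (e / norm_factor)) with (pos e) in h2
      by (field; lra).
    exact h2. }
  assert (zeroP : forall v : H, (forall e : posreal, norm v <= e) -> v = zero).
  { intros v h. apply hnorm_eq_zero. apply Rle_antisym; [|apply hnorm_ge_0].
    apply Rnot_lt_le; intros h1.
    assert (h2 : 0 < norm v / 2) by lra.
    specialize (h (mkposreal _ h2)). simpl in h. lra. }
  assert (eqP : forall u v : H, (forall e : posreal, norm (minus u v) <= e) -> u = v).
  { intros u v h. apply zeroP in h.
    apply (plus_reg_r (G := H) (opp v)).
    transitivity (zero : H); [exact h|symmetry; exact (plus_opp_r v)]. }
  assert (linL : is_linear (K := C_AbsRing) (U := H) (V := H) L).
  { split.
    - intros x y. apply eqP. intros e.
      assert (d0 : 0 < e / 3) by (pose proof (cond_pos e); lra).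
      pose (d := mkposreal _ d0).
      destruct (filter_ex _ (filter_and _ _ (hL (plus x y) d)
                  (filter_and _ _ (hL x d) (hL y d)))) as [T [h1 [h2 h3]]].
      simpl in h1, h2, h3.
      rewrite bop_morph_plus in h1.
      eapply Rle_trans; [apply (hnorm_minus_trans (plus (T x) (T y)))|].
      rewrite hnorm_minus_sym.
      apply Rle_trans with (e / 3 + (e / 3 + e / 3)); [|lra].
      apply Rplus_le_compat; [left; exact h1|].
      eapply Rle_trans; [apply hnorm_minus_plus|lra].
    - intros k x. apply eqP. intros e.
      assert (c0 : 0 <= Cmod k) by (apply Cmod_ge_0).
      assert (d1 : 0 < e / 2) by (pose proof (cond_pos e); lra).
      assert (d0 : 0 < e / 2 / (Cmod k + 1)) by (apply Rdiv_lt_0_compat; lra).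
      destruct (filter_ex _ (filter_and _ _ (hL (scal k x) (mkposreal _ d1))
                  (hL x (mkposreal _ d0)))) as [T [h1 h2]].
      simpl in h1, h2.
      rewrite bop_morph_scal in h1.
      eapply Rle_trans; [apply (hnorm_minus_trans (scal k (T x)))|].
      rewrite hnorm_minus_sym.
      apply Rle_trans with (e / 2 + e / 2); [|lra].
      apply Rplus_le_compat; [left; exact h1|].
      eapply Rle_trans; [apply hnorm_minus_scal|].
      apply Rle_trans with (Cmod k * (e / 2 / (Cmod k + 1))).
      + apply Rmult_le_compat_l; lra.
      + apply Rle_trans with ((Cmod k + 1) * (e / 2 / (Cmod k + 1))).
        * apply Rmult_le_compat_r; lra.
        * right; field; lra.
    - destruct (CF (mkposreal 1 Rlt_0_1)) as [T0 h0].
      destruct (bop_linear T0) as [_ _ [m [m0 hm]]].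
      exists (1 + m). split; [lra|]. intros x.
      apply Rnot_lt_le; intros h.
      assert (d0 : 0 < norm (L x) - (1 + m) * norm x) by lra.
      destruct (filter_ex _ (filter_and _ _ (hL x (mkposreal _ d0)) h0))
        as [T [h1 h2]].
      simpl in h1. change (bop_norm (minus T T0) < 1) in h2.
      pose proof (bop_norm_le (minus T T0) x) as h3.
      change (norm (minus (T x) (T0 x)) <= bop_norm (minus T T0) * norm x) in h3.
      pose proof (hnorm_ge_0 x) as hx. specialize (hm x).
      assert (bop_norm (minus T T0) * norm x <= 1 * norm x)
        by (apply Rmult_le_compat_r; lra).
      pose proof (hnorm_triangle_inv (L x) (T x)) as h4.
      pose proof (hnorm_triangle_inv (T x) (T0 x)) as h5.
      rewrite hnorm_minus_sym in h4.
      lra. }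
  exists (Bop L linL). intros e.
  assert (d0 : 0 < e / 4) by (pose proof (cond_pos e); lra).
  destruct (CF (mkposreal _ d0)) as [T0 h0].
  apply filter_imp with (2 := h0). intros T hT.
  change (bop_norm (minus T T0) < e / 4) in hT.
  change (bop_norm (minus T (Bop L linL)) < e).
  apply Rle_lt_trans with (3 * (e / 4)); [|lra].
  apply bop_norm_bound. intros x hx.
  change (norm (minus (T x) (L x)) <= 3 * (e / 4)).
  destruct (filter_ex _ (filter_and _ _ (hL x (mkposreal _ d0)) h0))
    as [T' [h1 h2]].
  simpl in h1. change (bop_norm (minus T' T0) < e / 4) in h2.
  pose proof (bop_norm_unit (minus T T0) x hx) as h3.
  pose proof (bop_norm_unit (minus T' T0) x hx) as h4.
  change (norm (minus (T x) (T0 x)) <= bop_norm (minus T T0)) in h3.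
  change (norm (minus (T' x) (T0 x)) <= bop_norm (minus T' T0)) in h4.
  pose proof (hnorm_minus_trans (T0 x) (T x) (L x)) as h5.
  pose proof (hnorm_minus_trans (T' x) (T0 x) (L x)) as h6.
  rewrite (hnorm_minus_sym (T0 x) (T' x)) in h6.
  lra.
Qed.

Definition bop_CompleteSpace_mixin : CompleteSpace.mixin_of bop_UniformSpace.
Proof.
  refine (CompleteSpace.Mixin bop_UniformSpace
            (fun F => epsilon (inhabits (bop_zero : boundedOp H))
                        (fun L => forall e : posreal, F (ball L e))) _ _).
  - intros F PF CF.
    apply (epsilon_spec (inhabits (bop_zero : boundedOp H))
             (fun L => forall e : posreal, F (ball L e))).
    apply bop_complete; assumption.
  - intros F1 F2 h12 h21.
    assert (E : F1 = F2).
    { apply functional_extensionality; intros P.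
      apply propositional_extensionality; split; [apply h21|apply h12]. }
    rewrite E. intros e. apply ball_center.
Defined.

Canonical bop_CompleteNormedModule :=
  CompleteNormedModule.Pack R_AbsRing (boundedOp H)
    (CompleteNormedModule.Class R_AbsRing _
       (NormedModule.class R_AbsRing bop_NormedModule)
       bop_CompleteSpace_mixin) (boundedOp H).

Definition is_bop_inv T S : Prop :=
  bop_comp S T = bop_id /\ bop_comp T S = bop_id.

Definition bop_invertible T : Prop := exists S, is_bop_inv T S.

(* Meaningful only when [T] is invertible. *)
Definition bop_inv T : boundedOp H := epsilon (inhabits bop_zero) (is_bop_inv T).

(* The relation T > 0. *)
Definition bop_pos T : Prop :=
  (forall x, 0 <= Re (inner (T x) x) /\ Im (inner (T x) x) = 0) /\
  bop_invertible T.

Definition spectrum T (z : C) : Prop :=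
  ~ bop_invertible (minus T (bop_cscal z bop_id)).

(* A list [a0; a1; ...] encodes the polynomial a0 + a1 X + ... *)
Definition poly_eval (p : list R) (t : R) : R :=
  fold_right (fun a s => a + t * s) 0 p.

Definition bop_poly (p : list R) T : boundedOp H :=
  fold_right (fun (a : R) S => plus (scal a bop_id) (bop_comp T S)) zero p.

(* Continuous functional calculus S = f(T) for a self-adjoint T and a real
   function f continuous on the spectrum of T (which is real): S is the
   operator-norm limit of p_n(T) for polynomials p_n converging to f uniformly
   on the spectrum. *)
Definition is_bop_fun (f : R -> R) T S : Prop :=
  exists p : nat -> list R,
    (forall e : posreal, eventually (fun n => forall t : R,
       spectrum T (RtoC t) -> Rabs (poly_eval (p n) t - f t) < e)) /\
    filterlim (fun n => bop_poly (p n) T) eventually (locally S).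

(* The power T^nu of an operator T > 0, whose spectrum lies in (0, +oo), where
   [Rpower t nu] is t^nu. *)
Definition bop_power T (nu : R) : boundedOp H :=
  epsilon (inhabits bop_zero) (is_bop_fun (fun t => Rpower t nu) T).

End Operators.

Declare Scope bop_scope.
Delimit Scope bop_scope with bop.
Bind Scope bop_scope with boundedOp.
Notation "S + T" := (plus S T) : bop_scope.
Notation "S - T" := (minus S T) : bop_scope.
Notation "S * T" := (bop_comp S T) : bop_scope.
Notation "T ^ nu" := (bop_power T nu%R) : bop_scope.
Notation "a *: T" := (scal (a%R : R) T)
  (at level 40, left associativity) : bop_scope.

Definition geomean {H : hilbertSpace} (nu : R) (A B : boundedOp H) : boundedOp H :=
  (A ^ (1 / 2) * (A ^ (- (1 / 2)) * B * A ^ (- (1 / 2))) ^ nu * A ^ (1 / 2))%bop.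

(* Main.v *)
Require Import Defs.
From Stdlib Require Import Reals Lra Lia List Classical ClassicalEpsilon.
From Coquelicot Require Import Coquelicot.
From Corelib Require ssreflect ssrfun ssrbool.
From mathcomp Require all_boot all_algebra Rstruct complex.
Open Scope R_scope.

(** For [0 < r < 1] and [t > 0] a Beta integral gives
[t^r = sin (r pi) / pi * int_0^oo l^(r-1) t / (t + l) dl]. Applied to the operator
[Y = X^(-1/2) Q X^(-1/2)] through the functional calculus and multiplied by
[X^(1/2)] on both sides, it becomes an integral representation of the geometric mean
of [X] and [Q], with kernel [l^(r-1) Q (Q + l X)^-1 X] ([geomean_integral]).
Subtract the representations for [X = D] and [X = C]. The difference of the kernels
is [l^(r-1) / l] times [Q (Q + l C)^-1 Q - Q (Q + l D)^-1 Q], which is the increment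
of [- Q (Q + l X)^-1 Q] when [X] runs along the segment from [C] to [D]; writing it as
the integral of its derivative gives the inner integral ([segment_is_RInt]). For
[r = 1] both geometric means equal [Q] and the sine vanishes, so that only the
convergence of the outer integral is left: its integrand is bounded near 0 and
[O (l^-2)] at infinity ([segment_product_integrable]).

Powers of operators are defined by polynomial approximation on the spectrum, so the
transfer from numbers to operators rests on the equality of the norm of [p T] with the
supremum of [|p|] over the spectrum of a symmetric [T] ([bop_norm_poly_le],
[poly_eval_le_norm]). If the norm [N] of [p T] is positive, then [N^2 - (p T)^2] is
positive and not invertible; and a nonzero polynomial whose value at [T] is not
invertible vanishes somewhere on the spectrum, because it splits into real linear
factors and quadratic factors [(X - a)^2 + b^2], and the latter are invertible at [T]
([poly_noninvertible]). Hence [f -> f(T)] is an isometry, and it is compatible with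
products, inverses, limits and Riemann integrals.

The constant comes from the alternating series with partial sums
[S_N = sum_(n <= N) (-1)^n (1 / (n + r) + 1 / (n + 1 - r))], into which the Beta
integral expands. The number [sin (r pi) S_N] is the integral over [[0, pi]] of
[cos ((r - 1/2) x) sin ((N + 1) x) / sin (x / 2)]; by the Riemann-Lebesgue lemma
the cosine can be replaced by 1, that is, [r] by [1 / 2], where the Leibniz series
gives the limit [pi] ([alt_sum_limit]). *)

(** * Complex roots of real polynomials *)

Definition cpoly_eval (p : list R) (z : C) : C :=
  fold_right (fun (a : R) s => Cplus (RtoC a) (Cmult z s)) (RtoC 0) p.

(** The field [complex R] over the real closed field [R] is algebraically closed;
its notations clash with those of [bop_scope], hence the prefix forms. *)
Module RealPolynomialRoot.

#[warnings="-ambiguous-paths"] Import -(notations) all_boot all_algebra Rstruct complex.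
Import Corelib.ssr.ssreflect Corelib.ssr.ssrfun Corelib.ssr.ssrbool.
Import GRing.Theory.
Local Notation "x +' y" := (GRing.add x y) (at level 50, left associativity).
Local Notation "x *' y" := (GRing.mul x y) (at level 40, left associativity).

Definition toC (z : complex R) : C := (complex.Re z, complex.Im z).

Lemma toC_mul x y : toC (x *' y) = Cmult (toC x) (toC y).
Proof. by case: x => a b; case: y => c d. Qed.

Lemma toC_add x y : toC (x +' y) = Cplus (toC x) (toC y).
Proof. by case: x => a b; case: y => c d. Qed.

Lemma monic_root (l : seq R) : l <> nil ->
  exists z : C, cpoly_eval (l ++ (1 :: nil)) z = RtoC 0.
Proof.
move=> l_neq0; have hl : leq 1 (size l) by case: l l_neq0.
have [x hx] := @complex_acf_axiom _ (size l)
  (fun i => Complex (Ropp (nth 0 l i)) 0) hl.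
exists (toC x).
suff H : cpoly_eval (l ++ (1 :: nil)) (toC x) =
   toC (GRing.exp x (size l) +'
        bigop GRing.zero (index_enum (ordinal (size l)))
          (fun i => BigBody i GRing.add true (Complex (nth 0 l i) 0 *' GRing.exp x i))).
  rewrite H hx -big_split /= big1 // => i _.
  rewrite -mulrDl.
  have -> : Complex (Ropp (nth 0 l i)) 0 +' Complex (nth 0 l i) 0 = GRing.zero :> complex R.
    by apply/eqP; rewrite eq_complex /= addNr addr0 !eqxx.
  by rewrite mul0r.
elim: l {l_neq0 hl hx} => [|a l IH] /=.
  rewrite big_ord0 addr0 expr0 /toC /= /RtoC /Cplus /Cmult /=.
  by rewrite !Rmult_0_r Rminus_0_r !Rplus_0_r.
rewrite IH big_ord_recl /= expr0 mulr1.
rewrite (_ : RtoC a = toC (Complex a 0)) // -toC_mul -toC_add; congr toC.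
rewrite mulrDr -exprS addrCA; congr (_ +' (_ +' _)).
rewrite mulr_sumr; apply: eq_bigr => i _.
by rewrite /bump /= add1n exprS mulrCA.
Qed.

End RealPolynomialRoot.

Lemma complex_root (l : list R) (c : R) : l <> nil -> c <> 0 ->
  exists z : C, cpoly_eval (l ++ c :: nil) z = RtoC 0.
Proof.
  intros hl hc.
  destruct (RealPolynomialRoot.monic_root (map (fun a => a / c) l)) as [z hz].
  { destruct l; [congruence|discriminate]. }
  exists z.
  assert (E : cpoly_eval (l ++ c :: nil) z =
    Cmult (RtoC c) (cpoly_eval (map (fun a => a / c) l ++ 1 :: nil) z)).
  { clear hz hl. induction l as [|a l IH]; simpl.
    - ring.
    - rewrite IH. unfold Rdiv. rewrite RtoC_mult, RtoC_inv by exact hc.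
      field. intros h; apply hc. now apply RtoC_inj. }
  rewrite E, hz. ring.
Qed.

(** * The integral of u^(r-1) / (1 + u) over (0, oo) *)

Definition alt_sum (r : R) (N : nat) : R :=
  sum_f_R0 (fun n => (-1) ^ n / (INR n + r)) N.

(** The Dirichlet kernel at half-integers: twice the real part of a geometric sum
of [exp (i (n + 1/2) x)], so that [sin (x / 2)] makes it telescope. *)
Definition half_dirichlet (N : nat) (x : R) : R :=
  sum_f_R0 (fun n => 2 * cos ((INR n + 1 / 2) * x)) N.

Lemma half_dirichlet_closed N x :
  sin (x / 2) * half_dirichlet N x = sin (INR (S N) * x).
Proof.
  unfold half_dirichlet. induction N as [|N IH].
  - simpl sum_f_R0. simpl INR.
    replace (1 * x) with (2 * (x / 2)) by field. rewrite sin_2a.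
    replace ((0 + 1 / 2) * x) with (x / 2) by field. ring.
  - rewrite tech5, Rmult_plus_distr_l, IH.
    replace (INR (S N) * x) with ((INR (S N) + 1 / 2) * x - x / 2) by field.
    rewrite (S_INR (S N)).
    replace ((INR (S N) + 1) * x) with ((INR (S N) + 1 / 2) * x + x / 2) by field.
    rewrite sin_plus, sin_minus. ring.
Qed.

Lemma is_RInt_cos_0_PI c : c <> 0 ->
  is_RInt (fun x => cos (c * x)) 0 PI (sin (c * PI) / c).
Proof.
  intros hc.
  replace (sin (c * PI) / c) with (minus (sin (c * PI) / c) (sin (c * 0) / c)).
  2:{ rewrite Rmult_0_r, sin_0. unfold minus, plus, opp; simpl. field; exact hc. }
  apply (is_RInt_derive (fun x => sin (c * x) / c)).
  - intros x _. auto_derive; [exact I|]. field; exact hc.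
  - intros x _. apply (ex_derive_continuous (fun x => cos (c * x))). now auto_derive.
Qed.

Lemma sin_shift n : forall y, sin (INR n * PI + y) = (-1) ^ n * sin y.
Proof.
  induction n as [|n IH]; intros y.
  - simpl. rewrite Rmult_0_l, Rplus_0_l. ring.
  - rewrite S_INR. replace ((INR n + 1) * PI + y) with (INR n * PI + (y + PI)) by ring.
    rewrite IH, neg_sin. simpl. ring.
Qed.

(** Multiplied by [sin (r pi)], the terms [(-1)^n / (n + r)] and
[(-1)^n / (n + 1 - r)] are the integrals of [cos ((n + r) x)] and
[cos ((n + 1 - r) x)], whose sum is [2 cos ((n + 1/2) x) cos ((r - 1/2) x)]. *)
Lemma half_dirichlet_integral r N : 0 < r < 1 ->
  is_RInt (fun x => cos ((r - 1 / 2) * x) * half_dirichlet N x) 0 PI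
    (sin (r * PI) * (alt_sum r N + alt_sum (1 - r) N)).
Proof.
  intros hr.
  assert (T : forall n, is_RInt
    (fun x => cos ((r - 1 / 2) * x) * (2 * cos ((INR n + 1 / 2) * x))) 0 PI
    (sin (r * PI) * ((-1) ^ n / (INR n + r) + (-1) ^ n / (INR n + (1 - r))))).
  { intros n. pose proof (pos_INR n) as hn.
    replace (sin (r * PI) * _) with
      (plus (sin ((INR n + r) * PI) / (INR n + r))
            (sin ((INR n + (1 - r)) * PI) / (INR n + (1 - r)))).
    - eapply is_RInt_ext; [|apply (is_RInt_plus (V := R_NormedModule)); apply is_RInt_cos_0_PI; lra].
      intros x _. simpl. unfold plus; simpl.
      replace ((INR n + r) * x) with ((INR n + 1 / 2) * x + (r - 1 / 2) * x) by field.
      replace ((INR n + (1 - r)) * x) with ((INR n + 1 / 2) * x - (r - 1 / 2) * x) by field.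
      rewrite cos_plus, cos_minus. ring.
    - unfold plus; simpl.
      rewrite !Rmult_plus_distr_r, !sin_shift, Rmult_minus_distr_r, Rmult_1_l.
      rewrite sin_PI_x. field. lra. }
  unfold half_dirichlet, alt_sum. induction N as [|N IH].
  - exact (T O).
  - rewrite !tech5.
    eapply is_RInt_ext; [|evar_last;
      [apply (is_RInt_plus (V := R_NormedModule) _ _ _ _ _ _ IH (T (S N)))|]].
    + intros x _. rewrite tech5. unfold plus; simpl. ring.
    + unfold plus; simpl. ring.
Qed.

(** [alt_sum (1 / 2)] is twice the Leibniz series for [pi / 4]. *)
Lemma Leibniz_half : is_lim_seq (fun N => alt_sum (1 / 2) N) (PI / 2).
Proof.
  rewrite <- Alt_PI_eq. unfold Alt_PI. destruct exist_PI as [a ha].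
  apply is_lim_seq_Reals in ha.
  replace (4 * a / 2) with (2 * a) by field.
  apply (is_lim_seq_ext (fun N => 2 * sum_f_R0 (tg_alt PI_tg) N)).
  - intros N. unfold alt_sum. rewrite scal_sum. apply sum_eq. intros n _.
    unfold tg_alt, PI_tg. rewrite plus_INR, mult_INR. simpl (INR 2). simpl (INR 1).
    pose proof (pos_INR n). field. lra.
  - apply (is_lim_seq_scal_l _ 2 a ha).
Qed.

(** Taylor bounds on [sin y] for [0 <= y <= 2]; the constant 6 is far from sharp,
but any linear lower bound will do. *)
Lemma sin_half_lower x : 0 <= x <= PI -> x / 6 <= sin (x / 2).
Proof.
  intros hx. pose proof PI_4. pose proof PI_RGT_0.
  destruct (SIN (x / 2)) as [h _]; [lra|lra|].
  unfold sin_lb, sin_approx, sin_term in h. simpl in h.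
  unfold Rdiv in *.
  set (y := x * / 2) in *.
  assert (0 <= y <= 2) by (unfold y; lra).
  replace (x * / 6) with (y * / 3) by (unfold y; field).
  apply Rle_trans with (2 := h).
  assert (E: y * / 3 <= y - y ^ 3 * / 6 + y ^ 5 * /120 - y ^ 7 * / 5040).
  { assert (0 <= y ^ 2 <= 4) by nra.
    assert (0 <= y^3) by (apply pow_le; lra).
    assert (0 <= y^5) by (apply pow_le; lra).
    assert (y ^ 3 <= 4 * y) by (simpl; nra).
    assert (y ^ 7 <= 4 * y ^ 5). { replace (y ^ 7) with (y ^ 2 * y ^ 5) by ring. nra. }
    lra. }
  lra.
Qed.

Lemma Rabs_sin_le y : Rabs (sin y) <= Rabs y.
Proof.
  assert (P : forall z, 0 < z -> Rabs (sin z) <= z).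
  { intros z hz. pose proof (sin_lt_x z hz). apply Rabs_le. split; [|lra].
    destruct (Rle_dec z PI) as [h|h].
    - pose proof (sin_ge_0 z). lra.
    - pose proof (SIN_bound z). pose proof PI2_1. unfold Rdiv in *. lra. }
  destruct (Rtotal_order y 0) as [h|[->|h]].
  - rewrite <- (Rabs_Ropp (sin y)), <- sin_neg, <- (Rabs_Ropp y), (Rabs_pos_eq (- y)) by lra.
    apply P. lra.
  - rewrite sin_0. lra.
  - rewrite (Rabs_pos_eq y) by lra. now apply P.
Qed.

Lemma Rabs_cos_sub_1_le y : Rabs (cos y - 1) <= y ^ 2 / 2.
Proof.
  replace (cos y) with (1 - 2 * sin (y / 2) * sin (y / 2)).
  2:{ rewrite <- cos_2a_sin. f_equal. field. }
  pose proof (Rabs_sin_le (y / 2)) as h. apply Rsqr_le_abs_1 in h. unfold Rsqr in h.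
  apply Rabs_le. split; nra.
Qed.

(** A Riemann-Lebesgue estimate with a rate. The integrand is
[phi x * sin (M x)] with [M = N + 1] and [phi x = (cos (a x) - 1) / sin (x / 2)].
Since the numerator is quadratic at 0, [phi] and its derivative are bounded on
(0, pi], and integration by parts gains the factor [1 / M]. As [phi] is undefined at
0, parts are taken on [[1 / M, pi]] only, and the short interval [[0, 1 / M]]
contributes [O (1 / M)] by boundedness. *)
Lemma cos_sub_1_half_dirichlet_small a : Rabs a <= 1 / 2 ->
  forall N v, is_RInt (fun x => (cos (a * x) - 1) * half_dirichlet N x) 0 PI v ->
  Rabs v <= 40 / INR (S N).
Proof.
  intros ha N v hI.
  pose proof (lt_0_INR (S N) (PeanoNat.Nat.lt_0_succ N)) as hM.
  assert (hM1 : 1 <= INR (S N)) by (rewrite S_INR; pose proof (pos_INR N); lra).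
  set (M := INR (S N)) in *.
  pose proof PI_4 as p4. pose proof PI2_3_2 as p3.
  set (d := 1 / M).
  assert (hd : 0 < d <= 1).
  { unfold d. split; [apply Rdiv_lt_0_compat; lra|].
    apply Rle_div_l; lra. }
  set (g := fun x => (cos (a * x) - 1) * half_dirichlet N x) in *.
  set (phi := fun x => (cos (a * x) - 1) / sin (x / 2)).
  set (dphi := fun x => (- a * sin (a * x) * sin (x / 2)
     - (cos (a * x) - 1) * (cos (x / 2) / 2)) / sin (x / 2) ^ 2).
  assert (a1 : forall x, 0 <= x -> Rabs (cos (a * x) - 1) <= x ^ 2 / 8).
  { intros x hx. eapply Rle_trans; [apply Rabs_cos_sub_1_le|].
    apply Rabs_le_between in ha. assert (a * a <= 1 / 4) by nra.
    pose proof (Rle_0_sqr x) as hs. unfold Rsqr in hs.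
    replace ((a * x) ^ 2) with (a * a * (x * x)) by ring. nra. }
  assert (spos : forall x, 0 < x <= PI -> 0 < sin (x / 2)).
  { intros x hx. pose proof (sin_half_lower x). lra. }
  assert (gphi : forall x, 0 < x <= PI -> g x = phi x * sin (M * x)).
  { intros x hx. unfold g, phi, M. rewrite <- half_dirichlet_closed.
    pose proof (spos x hx). field. lra. }
  assert (phib : forall x, 0 < x <= PI -> Rabs (phi x) <= 3 / 4 * x).
  { intros x hx. unfold phi, Rdiv at 1. rewrite Rabs_mult, Rabs_inv.
    pose proof (spos x hx) as s0. rewrite (Rabs_pos_eq (sin (x / 2))) by lra.
    apply Rle_div_l; [lra|]. pose proof (sin_half_lower x). pose proof (a1 x).
    apply Rle_trans with (x ^ 2 / 8); [apply a1; lra|]. simpl. nra. }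
  assert (dphib : forall x, 0 < x <= PI -> Rabs (dphi x) <= 7).
  { intros x hx. unfold dphi, Rdiv at 1. rewrite Rabs_mult, Rabs_inv.
    pose proof (spos x hx) as s0. pose proof (sin_half_lower x ltac:(lra)) as s1.
    assert (s2 : x ^ 2 / 36 <= sin (x / 2) ^ 2) by (simpl; nra).
    assert (0 < x ^ 2) by (apply pow_lt; lra).
    rewrite (Rabs_pos_eq (sin (x / 2) ^ 2)) by lra.
    apply Rle_div_l; [lra|].
    assert (Rabs (- a * sin (a * x) * sin (x / 2)) <= x ^ 2 / 8).
    { rewrite !Rabs_mult, Rabs_Ropp.
      pose proof (Rabs_sin_le (a * x)) as q1. pose proof (Rabs_sin_le (x / 2)) as q2.
      rewrite Rabs_mult in q1. rewrite (Rabs_pos_eq x) in q1 by lra.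
      rewrite (Rabs_pos_eq (x / 2)) in q2 by lra.
      pose proof (Rabs_pos a). pose proof (Rabs_pos (sin (a * x))).
      pose proof (Rabs_pos (sin (x / 2))).
      assert (Rabs (sin (a * x)) <= x / 2) by nra.
      assert (Rabs a * Rabs (sin (a * x)) <= x / 4) by nra.
      simpl; nra. }
    assert (Rabs ((cos (a * x) - 1) * (cos (x / 2) / 2)) <= x ^ 2 / 16).
    { rewrite Rabs_mult. pose proof (a1 x ltac:(lra)).
      assert (Rabs (cos (x / 2) / 2) <= 1 / 2).
      { pose proof (COS_bound (x / 2)). apply Rabs_le. lra. }
      pose proof (Rabs_pos (cos (a * x) - 1)). nra. }
    eapply Rle_trans; [apply Rabs_triang|]. rewrite Rabs_Ropp. nra. }
  assert (gc : forall x, continuous g x).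
  { intros x. unfold g. apply (continuous_mult (K := R_AbsRing)).
    - apply (ex_derive_continuous (fun x => cos (a * x) - 1)). now auto_derive.
    - unfold half_dirichlet. clear. induction N as [|N IH]; simpl sum_f_R0.
      + apply (ex_derive_continuous (fun x => 2 * cos ((0 + 1 / 2) * x))). now auto_derive.
      + apply (continuous_plus (V := R_NormedModule)); [exact IH|].
        apply (ex_derive_continuous (fun x => 2 * cos ((INR (S N) + 1 / 2) * x))). now auto_derive. }
  assert (h1 : ex_RInt g 0 d).
  { apply (ex_RInt_continuous (V := R_CompleteNormedModule)). intros; apply gc. }
  assert (h2 : ex_RInt g d PI).
  { apply (ex_RInt_continuous (V := R_CompleteNormedModule)). intros; apply gc. }
  apply (is_RInt_unique (V := R_CompleteNormedModule)) in hI.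
  rewrite <- (RInt_Chasles (V := R_CompleteNormedModule) g 0 d PI h1 h2) in hI.
  rewrite <- hI. clear hI v. unfold plus; simpl.
  assert (b1 : Rabs (RInt g 0 d) <= 3 * d).
  { rewrite <- (Rminus_0_r d) at 2. rewrite (Rmult_comm 3).
    apply (norm_RInt_le_const (V := R_NormedModule) g 0 d); [lra| |].
    2: now apply (RInt_correct (V := R_CompleteNormedModule)).
    intros x hx. change (norm (g x)) with (Rabs (g x)).
    destruct (Req_dec x 0) as [->|hx0].
    - unfold g. rewrite Rmult_0_r, cos_0, Rminus_diag, Rmult_0_l, Rabs_R0. lra.
    - rewrite gphi by lra. rewrite Rabs_mult. pose proof (phib x ltac:(lra)).
      pose proof (SIN_bound (M * x)). assert (Rabs (sin (M * x)) <= 1) by (apply Rabs_le; lra).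
      pose proof (Rabs_pos (phi x)). nra. }
  (* [- phi x sin (M x) + k x] is the derivative of [phi x cos (M x) / M]. *)
  set (k := fun x => dphi x * cos (M * x) / M).
  assert (dphiD : forall x, 0 < x <= PI -> is_derive phi x (dphi x)).
  { intros x hx. unfold phi, dphi. pose proof (spos x hx).
    auto_derive; [lra|]. unfold Rdiv in *. field. lra. }
  assert (kc : forall x, d <= x <= PI -> continuous k x).
  { intros x hx. pose proof (spos x ltac:(lra)). unfold k, dphi.
    match goal with |- continuous ?f x => apply (ex_derive_continuous f) end.
    auto_derive. repeat split; try lra. simpl. nra. }
  assert (hk : ex_RInt k d PI).
  { apply (ex_RInt_continuous (V := R_CompleteNormedModule)).
    intros x. rewrite Rmin_left, Rmax_right by lra. apply kc. }
  assert (E : is_RInt (fun x => plus (opp (g x)) (k x)) d PI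
     (minus (phi PI * cos (M * PI) / M) (phi d * cos (M * d) / M))).
  { eapply is_RInt_ext; [|apply (is_RInt_derive (fun x => phi x * cos (M * x) / M)
        (fun x => - phi x * sin (M * x) + k x))].
    - intros x. rewrite Rmin_left, Rmax_right by lra. intros hx.
      rewrite gphi by lra. unfold plus, opp; simpl. ring.
    - intros x. rewrite Rmin_left, Rmax_right by lra. intros hx.
      pose proof (dphiD x ltac:(lra)) as hD.
      auto_derive; [exists (dphi x); exact hD|].
      replace (Derive (fun x => phi x) x) with (dphi x)
        by (symmetry; apply is_derive_unique, hD).
      unfold k. field. lra.
    - intros x. rewrite Rmin_left, Rmax_right by lra. intros hx.
      apply (continuous_plus (V := R_NormedModule)); [|apply kc; lra].
      apply (continuous_mult (K := R_AbsRing)).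
      + apply (continuous_opp (V := R_NormedModule)), (ex_derive_continuous phi).
        eexists; apply dphiD; lra.
      + apply (ex_derive_continuous (fun x => sin (M * x))). now auto_derive. }
  apply (is_RInt_unique (V := R_CompleteNormedModule)) in E.
  rewrite (RInt_plus (V := R_CompleteNormedModule)) in E;
    [|now apply (ex_RInt_opp (V := R_NormedModule))|exact hk].
  rewrite (RInt_opp (V := R_CompleteNormedModule)) in E by exact h2.
  unfold plus, opp, minus in E; simpl in E. unfold plus, opp in E; simpl in E.
  assert (b2 : Rabs (RInt k d PI) <= 7 * d * (PI - d)).
  { rewrite Rmult_comm. apply (norm_RInt_le_const (V := R_NormedModule) k d PI); [lra| |].
    2: now apply (RInt_correct (V := R_CompleteNormedModule)).
    intros x hx. change (norm (k x)) with (Rabs (k x)). unfold k, Rdiv.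
    rewrite !Rabs_mult, Rabs_inv, (Rabs_pos_eq M) by lra.
    replace (7 * d) with (7 * 1 * / M) by (unfold d; field; lra).
    apply Rmult_le_compat_r; [left; now apply Rinv_0_lt_compat|].
    apply Rmult_le_compat; try apply Rabs_pos; [apply dphib; lra|].
    apply Rabs_le, COS_bound. }
  assert (b3 : forall x, 0 < x <= PI -> Rabs (phi x * cos (M * x) / M) <= 3 * d).
  { intros x hx. unfold Rdiv.
    rewrite !Rabs_mult, Rabs_inv, (Rabs_pos_eq M) by lra.
    replace (3 * d) with (3 * 1 * / M) by (unfold d; field; lra).
    apply Rmult_le_compat_r; [left; now apply Rinv_0_lt_compat|].
    apply Rmult_le_compat; try apply Rabs_pos; [pose proof (phib x hx); lra|].
    apply Rabs_le, COS_bound. }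
  pose proof (b3 d ltac:(lra)) as b4. pose proof (b3 PI ltac:(lra)) as b5.
  replace (40 / M) with (40 * d) by (unfold d; field; lra).
  apply Rabs_le_between in b1, b2, b4, b5. apply Rabs_le.
  (* 3 from [b1], at most 28 from [b2] and 3 from each boundary value. *)
  assert (d * (PI - d) <= 4 * d) by nra. nra.
Qed.
(** [half_dirichlet_integral] at [r] and at [1 / 2] differ by a Riemann-Lebesgue
term, and at [1 / 2] the limit is known from the Leibniz series. *)
Lemma alt_sum_limit r : 0 < r < 1 ->
  is_lim_seq (fun N => alt_sum r N + alt_sum (1 - r) N) (PI / sin (r * PI)).
Proof.
  intros hr. pose proof PI_RGT_0 as hpi.
  assert (s0 : 0 < sin (r * PI)) by (apply sin_gt_0; nra).
  set (S := fun q N => alt_sum q N + alt_sum (1 - q) N).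
  assert (hd : is_lim_seq (fun N => sin (r * PI) * S r N - S (1 / 2) N) 0).
  { assert (h0 : is_lim_seq (fun N => 40 * / INR (N + 1)) 0).
    { replace (Finite 0) with (Rbar_mult 40 0) by (simpl; f_equal; ring).
      apply is_lim_seq_scal_l.
      apply (is_lim_seq_incr_n (fun N => / INR N) 1).
      replace (Finite 0) with (Rbar_inv p_infty) by reflexivity.
      apply is_lim_seq_inv; [apply is_lim_seq_INR|discriminate]. }
    apply is_lim_seq_abs_0.
    apply (is_lim_seq_le_le (fun _ => 0) _ (fun N => 40 * / INR (N + 1)));
      [|apply is_lim_seq_const|exact h0].
    intros N. split; [apply Rabs_pos|].
    rewrite PeanoNat.Nat.add_1_r.
    apply (cos_sub_1_half_dirichlet_small (r - 1 / 2)); [apply Rabs_le; lra|].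
    pose proof (half_dirichlet_integral r N hr) as h1.
    pose proof (half_dirichlet_integral (1 / 2) N ltac:(lra)) as h2.
    replace (1 / 2 * PI) with (PI / 2) in h2 by field.
    rewrite sin_PI2, Rmult_1_l in h2.
    eapply is_RInt_ext; [|exact (is_RInt_minus (V := R_NormedModule) _ _ _ _ _ _ h1 h2)].
    intros x _. unfold minus, plus, opp; simpl.
    rewrite (Rminus_diag (1 / 2)), Rmult_0_l, cos_0. ring. }
  assert (hh : is_lim_seq (S (1 / 2)) PI).
  { apply (is_lim_seq_ext (fun N => 2 * alt_sum (1 / 2) N)).
    - intros N. unfold S. replace (1 - 1 / 2) with (1 / 2) by field. ring.
    - replace (Finite PI) with (Rbar_mult 2 (PI / 2)) by (simpl; f_equal; field).
      apply is_lim_seq_scal_l, Leibniz_half. }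
  apply (is_lim_seq_ext
    (fun N => / sin (r * PI) * (sin (r * PI) * S r N - S (1 / 2) N + S (1 / 2) N))).
  { intros N. unfold S. field. lra. }
  replace (Finite (PI / sin (r * PI)))
    with (Rbar_mult (/ sin (r * PI)) (0 + PI)) by (simpl; f_equal; field; lra).
  apply is_lim_seq_scal_l. now apply is_lim_seq_plus'.
Qed.

Definition beta_kernel (r u : R) : R := Rpower u (r - 1) / (1 + u).

Lemma beta_kernel_continuous r u : 0 < u -> continuous (beta_kernel r) u.
Proof.
  intros hu. apply (ex_derive_continuous (beta_kernel r)). unfold beta_kernel, Rpower.
  auto_derive. lra.
Qed.

Lemma ex_RInt_beta_kernel r a b : 0 < a -> 0 < b -> ex_RInt (beta_kernel r) a b.
Proof.
  intros ha hb. apply (ex_RInt_continuous (V := R_CompleteNormedModule)).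
  intros u hu. apply beta_kernel_continuous.
  apply Rlt_le_trans with (2 := proj1 hu). now apply Rmin_glb_lt.
Qed.

Lemma beta_kernel_succ r u : 0 < u ->
  beta_kernel r u + beta_kernel (r + 1) u = Rpower u (r - 1).
Proof.
  intros hu. unfold beta_kernel.
  replace (r + 1 - 1) with (r - 1 + 1) by ring.
  rewrite Rpower_plus, Rpower_1 by lra. field. lra.
Qed.

(** Consecutive kernels add up to the power [u^(r-1)]; iterating this identity
expands the integral over [[x, 1]] in the alternating series of [alt_sum r]. *)
Lemma beta_head_succ r x : 0 < r -> 0 < x <= 1 ->
  RInt (beta_kernel r) x 1 + RInt (beta_kernel (r + 1)) x 1 = (1 - Rpower x r) / r.
Proof.
  intros hr hx.
  pose proof (ex_RInt_beta_kernel r x 1 ltac:(lra) ltac:(lra)) as h1.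
  pose proof (ex_RInt_beta_kernel (r + 1) x 1 ltac:(lra) ltac:(lra)) as h2.
  transitivity (RInt (fun u => plus (beta_kernel r u) (beta_kernel (r + 1) u)) x 1).
  { symmetry. exact (RInt_plus (V := R_CompleteNormedModule) _ _ _ _ h1 h2). }
  apply (is_RInt_unique (V := R_CompleteNormedModule)).
  replace ((1 - Rpower x r) / r) with (minus (Rpower 1 r / r) (Rpower x r / r)).
  2:{ unfold minus, plus, opp; simpl.
      unfold Rpower at 1. rewrite ln_1, Rmult_0_r, exp_0. field. lra. }
  eapply is_RInt_ext; [|apply (is_RInt_derive (fun u => Rpower u r / r)
    (fun u => Rpower u (r - 1)))].
  - intros u. rewrite Rmin_left, Rmax_right by lra. intros hu.
    symmetry. apply beta_kernel_succ. lra.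
  - intros u. rewrite Rmin_left, Rmax_right by lra. intros hu.
    replace (Rpower u (r - 1)) with (Rpower u r * / u).
    + unfold Rpower. auto_derive; [lra|]. field. lra.
    + unfold Rminus. rewrite Rpower_plus, Rpower_Ropp, Rpower_1 by lra. reflexivity.
  - intros u. rewrite Rmin_left, Rmax_right by lra. intros hu.
    apply (ex_derive_continuous (fun u => Rpower u (r - 1))). unfold Rpower.
    auto_derive. lra.
Qed.

Lemma beta_head_pos r x : 0 < x <= 1 -> 0 <= RInt (beta_kernel r) x 1.
Proof.
  intros hx. apply RInt_ge_0; [lra|apply ex_RInt_beta_kernel; lra|].
  intros u hu. unfold beta_kernel, Rpower. pose proof (exp_pos ((r - 1) * ln u)).
  apply Rdiv_le_0_compat; lra.
Qed.

Lemma beta_head_bound r x : 0 < r -> 0 < x <= 1 -> RInt (beta_kernel r) x 1 <= / r.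
Proof.
  intros hr hx. pose proof (beta_head_succ r x hr hx) as h.
  pose proof (beta_head_pos (r + 1) x hx).
  assert ((1 - Rpower x r) / r <= / r); [|lra].
  unfold Rpower. pose proof (exp_pos (r * ln x)). pose proof (Rinv_0_lt_compat r hr).
  unfold Rdiv. nra.
Qed.

(** The first error term collects the [N + 1] boundary values at [x], the second is
the remaining integral, with exponent raised by [N + 1]. *)
Lemma beta_head_alt_sum r x N : 0 < r -> 0 < x <= 1 ->
  Rabs (RInt (beta_kernel r) x 1 - alt_sum r N) <=
  INR (S N) * (Rpower x r / r) + / INR (S N).
Proof.
  intros hr hx.
  assert (E : forall N, exists e, Rabs e <= INR (S N) * (Rpower x r / r) /\
    RInt (beta_kernel r) x 1 - alt_sum r N =
    e + (-1) ^ S N * RInt (beta_kernel (INR (S N) + r)) x 1).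
  { assert (P : forall n, Rabs ((-1) ^ n * (- Rpower x (INR n + r)) / (INR n + r))
       <= Rpower x r / r).
    { intros n. pose proof (pos_INR n). unfold Rdiv.
      rewrite !Rabs_mult, pow_1_abs, Rabs_Ropp, Rabs_inv, Rmult_1_l.
      rewrite (Rabs_pos_eq (INR n + r)), (Rabs_pos_eq (Rpower _ _)) by (try lra; left; apply exp_pos).
      apply Rmult_le_compat; [left; apply exp_pos| |  |].
      - left; apply Rinv_0_lt_compat; lra.
      - assert (ln x <= 0). { rewrite <- ln_1. apply ln_le; lra. }
        assert (le : (INR n + r) * ln x <= r * ln x) by nra.
        destruct (Rle_lt_or_eq_dec _ _ le) as [lt|eq].
        + left. now apply exp_increasing.
        + right. unfold Rpower. now rewrite eq.
      - apply Rinv_le_contravar; lra. }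
    clear N. induction N as [|N [e [he IH]]].
    - exists ((-1) ^ 0 * (- Rpower x (INR 0 + r)) / (INR 0 + r)). split.
      + change (INR 1) with 1. rewrite (Rmult_1_l (Rpower x r / r)). apply P.
      + unfold alt_sum. simpl. pose proof (beta_head_succ r x hr hx) as h.
        rewrite (Rplus_comm 1 r). rewrite !Rplus_0_l.
        replace (RInt (beta_kernel r) x 1)
          with ((1 - Rpower x r) / r - RInt (beta_kernel (r + 1)) x 1) by lra.
        field. lra.
    - exists (e + (-1) ^ (S N) * (- Rpower x (INR (S N) + r)) / (INR (S N) + r)). split.
      + eapply Rle_trans; [apply Rabs_triang|]. rewrite (S_INR (S N)).
        rewrite Rmult_plus_distr_r, (Rmult_1_l (Rpower x r / r)).
        apply Rplus_le_compat; [exact he|apply P].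
      + unfold alt_sum in *. rewrite tech5.
        pose proof (pos_INR (S N)).
        pose proof (beta_head_succ (INR (S N) + r) x ltac:(lra) hx) as h.
        rewrite (S_INR (S N)). replace (INR (S N) + 1 + r) with (INR (S N) + r + 1) by ring.
        replace (RInt (beta_kernel (INR (S N) + r)) x 1) with
          ((1 - Rpower x (INR (S N) + r)) / (INR (S N) + r)
           - RInt (beta_kernel (INR (S N) + r + 1)) x 1) in IH by lra.
        transitivity (e + (-1) ^ S N * ((1 - Rpower x (INR (S N) + r)) / (INR (S N) + r) -
           RInt (beta_kernel (INR (S N) + r + 1)) x 1) - (-1) ^ S N / (INR (S N) + r));
          [rewrite <- IH; ring|].
        rewrite <- (tech_pow_Rmult (-1) (S N)). field. lra. }
  destruct (E N) as [e [he ->]].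
  eapply Rle_trans; [apply Rabs_triang|]. apply Rplus_le_compat; [exact he|].
  rewrite Rabs_mult, pow_1_abs, Rmult_1_l.
  pose proof (lt_0_INR (S N) (PeanoNat.Nat.lt_0_succ N)).
  rewrite Rabs_pos_eq by now apply beta_head_pos.
  eapply Rle_trans; [apply beta_head_bound; lra|]. apply Rinv_le_contravar; lra.
Qed.

(** The substitution [u -> 1 / u] exchanges [r] and [1 - r]. *)
Lemma beta_tail_eq_head r b : 1 <= b ->
  RInt (beta_kernel r) 1 b = RInt (beta_kernel (1 - r)) (/ b) 1.
Proof.
  intros hb.
  pose proof (RInt_comp (V := R_CompleteNormedModule) (beta_kernel (1 - r)) Rinv
     (fun y => - / y ^ 2) 1 b) as h.
  rewrite Rmin_left, Rmax_right, Rinv_1 in h by lra.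
  assert (hib : 0 < / b) by (apply Rinv_0_lt_compat; lra).
  transitivity (opp (RInt (beta_kernel (1 - r)) 1 (/ b))).
  2:{ apply (opp_RInt_swap (V := R_CompleteNormedModule)). apply ex_RInt_beta_kernel; lra. }
  rewrite <- h; clear h.
  - rewrite <- (RInt_opp (V := R_CompleteNormedModule)).
    + apply RInt_ext. intros y. rewrite Rmin_left, Rmax_right by lra. intros hy.
      unfold scal, opp, beta_kernel; simpl. unfold mult; simpl.
      unfold Rpower. rewrite ln_Rinv by lra.
      replace ((1 - r - 1) * - ln y) with ((r - 1) * ln y + ln y) by ring.
      rewrite exp_plus, exp_ln by lra. field. lra.
    + apply (ex_RInt_continuous (V := R_CompleteNormedModule)).
      intros y. rewrite Rmin_left, Rmax_right by lra. intros hy.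
      unfold scal; simpl. unfold mult; simpl.
      apply (ex_derive_continuous (fun y => - / (y * (y * 1)) * beta_kernel (1 - r) (/ y))).
      unfold beta_kernel, Rpower. pose proof (Rinv_0_lt_compat y).
      auto_derive. repeat split; try lra; try nra.
  - intros y hy. apply beta_kernel_continuous, Rinv_0_lt_compat. lra.
  - intros y hy. split.
    + auto_derive; [lra|]. field. lra.
    + apply (ex_derive_continuous (fun y => - / y ^ 2)). auto_derive. simpl. nra.
Qed.

Lemma Rpower_le_small r e x : 0 < r -> 0 < x <= Rpower e (/ r) -> 0 < e -> Rpower x r <= e.
Proof.
  intros hr hx he. apply Rle_trans with (Rpower (Rpower e (/ r)) r).
  - apply Rle_Rpower_l; lra.
  - rewrite Rpower_mult, Rinv_l, Rpower_1 by lra. lra.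
Qed.

(** The improper integral is stated with one parameter [d] for both ends, which
makes it easy to use uniformly in a spectral parameter. *)
Lemma beta_integral r : 0 < r < 1 -> forall e, 0 < e ->
  exists d, 0 < d <= 1 /\ forall a b, 0 < a <= d -> / d <= b ->
  Rabs (RInt (beta_kernel r) a b - PI / sin (r * PI)) <= e.
Proof.
  intros hr e he.
  pose proof (alt_sum_limit r hr) as hl. apply is_lim_seq_Reals in hl.
  destruct (hl (e / 2) ltac:(lra)) as [N0 hN0].
  destruct (archimed_cor1 (e / 8) ltac:(lra)) as [N1 [hN1 hN1']].
  set (N := Nat.max N0 N1).
  assert (hN : / INR (S N) <= e / 8).
  { left. apply Rle_lt_trans with (2 := hN1). apply Rinv_le_contravar.
    - apply lt_0_INR; lia.
    - apply le_INR. lia. }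
  specialize (hN0 N ltac:(lia)). unfold Rdist in hN0.
  pose proof (lt_0_INR (S N) (PeanoNat.Nat.lt_0_succ N)) as hM.
  set (M := INR (S N)) in *.
  assert (P : forall q, 0 < q < 1 -> exists d, 0 < d <= 1 /\
    forall x, 0 < x <= d -> M * (Rpower x q / q) <= e / 8).
  { intros q hq. exists (Rmin 1 (Rpower (e / 8 * q / M) (/ q))).
    assert (0 < e / 8 * q / M) by (apply Rdiv_lt_0_compat; nra).
    split; [split; [apply Rmin_glb_lt; [lra|apply exp_pos]|apply Rmin_l]|].
    intros x [hx hx']. pose proof (Rmin_r 1 (Rpower (e / 8 * q / M) (/ q))).
    pose proof (Rpower_le_small q (e / 8 * q / M) x) as h.
    apply Rle_trans with (M * (e / 8 * q / M / q)).
    - apply Rmult_le_compat_l; [lra|]. apply Rmult_le_compat_r.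
      + left; apply Rinv_0_lt_compat; lra.
      + apply h; lra.
    - right. field. lra. }
  destruct (P r hr) as [d1 [hd1 P1]]. destruct (P (1 - r) ltac:(lra)) as [d2 [hd2 P2]].
  set (d := Rmin d1 d2).
  assert (hd : 0 < d <= 1).
  { unfold d. split; [apply Rmin_glb_lt; lra|]. pose proof (Rmin_l d1 d2). lra. }
  pose proof (Rmin_l d1 d2) as m1. pose proof (Rmin_r d1 d2) as m2. fold d in m1, m2.
  exists d. split; [exact hd|]. intros a b ha hb.
  assert (1 <= / d). { rewrite <- Rinv_1 at 1. apply Rinv_le_contravar; lra. }
  assert (hib : 0 < / b <= d).
  { split; [apply Rinv_0_lt_compat; lra|]. rewrite <- (Rinv_inv d).
    apply Rinv_le_contravar; lra. }
  rewrite <- (RInt_Chasles (V := R_CompleteNormedModule) _ a 1 b)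
    by (apply ex_RInt_beta_kernel; lra).
  rewrite (beta_tail_eq_head r b) by lra.
  pose proof (beta_head_alt_sum r a N ltac:(lra) ltac:(lra)) as h1.
  pose proof (beta_head_alt_sum (1 - r) (/ b) N ltac:(lra) ltac:(lra)) as h2.
  specialize (P1 a ltac:(lra)). specialize (P2 (/ b) ltac:(lra)).
  fold M in h1, h2. unfold plus; simpl.
  apply Rabs_le_between in h1, h2. apply Rabs_def2 in hN0. apply Rabs_le. lra.
Qed.
(** The substitution [l = t u] reduces the integral to [t^r] times a Beta integral
with ends [a / t] and [b / t]; for [t] in a compact subset of (0, oo) these ends
tend to 0 and infinity uniformly. *)
Lemma power_integral r m M : 0 < r < 1 -> 0 < m <= M -> forall e, 0 < e ->
  exists d, 0 < d <= 1 /\ forall a b, 0 < a <= d -> / d <= b ->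
  forall t, m <= t <= M ->
  Rabs (sin (r * PI) / PI * RInt (fun l => Rpower l (r - 1) * (t / (t + l))) a b
        - Rpower t r) <= e.
Proof.
  intros hr hm e he. pose proof PI_RGT_0 as hpi.
  assert (s0 : 0 < sin (r * PI)) by (apply sin_gt_0; nra).
  set (k := sin (r * PI) / PI).
  assert (hk : 0 < k) by now apply Rdiv_lt_0_compat.
  assert (hMr : 0 < Rpower M r) by apply exp_pos.
  destruct (beta_integral r hr (e / (k * Rpower M r))) as [d [hd hB]].
  { apply Rdiv_lt_0_compat; [lra|]. now apply Rmult_lt_0_compat. }
  set (d' := Rmin 1 (Rmin (d * m) (d / M))).
  assert (0 < d * m) by nra.
  assert (0 < d / M) by (apply Rdiv_lt_0_compat; lra).
  assert (hd' : 0 < d' <= 1).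
  { unfold d'. split; [repeat apply Rmin_glb_lt; lra|apply Rmin_l]. }
  assert (hd1 : d' <= d * m).
  { unfold d'. eapply Rle_trans; [apply Rmin_r|apply Rmin_l]. }
  assert (hd2 : d' <= d / M).
  { unfold d'. eapply Rle_trans; [apply Rmin_r|apply Rmin_r]. }
  exists d'. split; [exact hd'|]. intros a b ha hb t ht.
  assert (hd3 : M / d <= b).
  { eapply Rle_trans; [|exact hb]. replace (M / d) with (/ (d / M)) by (field; lra).
    apply Rinv_le_contravar; lra. }
  assert (hb0 : 0 < b).
  { apply Rlt_le_trans with (/ d'); [apply Rinv_0_lt_compat; lra|exact hb]. }
  assert (E : RInt (fun l => Rpower l (r - 1) * (t / (t + l))) a b =
    Rpower t r * RInt (beta_kernel r) (/ t * a + 0) (/ t * b + 0)).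
  { assert (it : 0 < / t) by (apply Rinv_0_lt_compat; lra).
    assert (ex : ex_RInt (beta_kernel r) (/ t * a + 0) (/ t * b + 0)).
    { apply ex_RInt_beta_kernel; nra. }
    rewrite <- (RInt_comp_lin (V := R_CompleteNormedModule)) by exact ex.
    change (Rpower t r * ?x) with (scal (Rpower t r) x).
    rewrite <- (RInt_scal (V := R_CompleteNormedModule)).
    2:{ apply (ex_RInt_comp_lin (V := R_NormedModule)). exact ex. }
    apply RInt_ext. intros l hl.
    assert (0 < l).
    { apply Rlt_trans with (2 := proj1 hl). apply Rmin_glb_lt; lra. }
    unfold scal, beta_kernel; simpl. unfold mult; simpl. rewrite Rplus_0_r.
    unfold Rpower. rewrite ln_mult, ln_Rinv by lra.
    replace ((r - 1) * (- ln t + ln l)) with ((r - 1) * ln l + - (r * ln t) + ln t) by ring.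
    rewrite !exp_plus, exp_Ropp, exp_ln by lra.
    pose proof (exp_pos (r * ln t)). field. repeat split; nra. }
  rewrite E, !Rplus_0_r. clear E.
  specialize (hB (/ t * a) (/ t * b)).
  assert (it : / M <= / t <= / m) by (split; apply Rinv_le_contravar; lra).
  assert (0 < / M) by (apply Rinv_0_lt_compat; lra).
  assert (Rpower t r <= Rpower M r) by (apply Rle_Rpower_l; lra).
  assert (0 < Rpower t r) by apply exp_pos.
  assert (h : Rabs (RInt (beta_kernel r) (/ t * a) (/ t * b) - PI / sin (r * PI)) <=
    e / (k * Rpower M r)).
  { apply hB.
    - split; [nra|]. apply Rle_trans with (/ m * (d * m)); [|right; field; lra].
      apply Rmult_le_compat; lra.
    - apply Rle_trans with (/ M * (M / d)); [right; field; lra|].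
      apply Rmult_le_compat; try lra. apply Rlt_le, Rdiv_lt_0_compat; lra. }
  replace (k * _ - _) with
    (k * Rpower t r * (RInt (beta_kernel r) (/ t * a) (/ t * b) - PI / sin (r * PI))).
  2:{ unfold k. field. lra. }
  rewrite Rabs_mult, (Rabs_pos_eq (k * Rpower t r)) by nra.
  apply Rle_trans with (k * Rpower M r * (e / (k * Rpower M r))).
  - apply Rmult_le_compat; [nra|apply Rabs_pos|nra|exact h].
  - right. field. lra.
Qed.

(** * The real inner product and operator identities *)

(** Real parts suffice for everything below: the spectrum enters only through real
numbers, and positivity over the complex field already forces symmetry of [rip]
([bop_pos_rsym]). *)
Definition rip {H : hilbertSpace} (x y : H) : R := Re (inner x y).

Section Hilbert.
Context {H : hilbertSpace}.
Implicit Types (x y z : H) (S T A B : boundedOp H).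

Lemma rip_plus_l x y z : rip (plus x y) z = rip x z + rip y z.
Proof. unfold rip. rewrite inner_plus_l. reflexivity. Qed.

Lemma rip_scal_l (a : R) x y : rip (scal (RtoC a) x) y = a * rip x y.
Proof. unfold rip. rewrite inner_scal_l. unfold Re, Cmult, RtoC; simpl. ring. Qed.

Lemma rip_sym x y : rip x y = rip y x.
Proof. unfold rip. now rewrite (inner_conj H y x). Qed.

Lemma rip_self x : rip x x = norm x ^ 2.
Proof. unfold rip. now rewrite inner_norm. Qed.

Lemma rip_plus_r x y z : rip z (plus x y) = rip z x + rip z y.
Proof. rewrite !(rip_sym z). apply rip_plus_l. Qed.

Lemma rip_scal_r (a : R) x y : rip x (scal (RtoC a) y) = a * rip x y.
Proof. rewrite !(rip_sym x). apply rip_scal_l. Qed.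

Lemma rip_zero_l y : rip zero y = 0.
Proof.
  pose proof (rip_plus_l zero zero y) as h.
  rewrite (plus_zero_l (zero : H) : plus (zero : H) zero = zero) in h. lra.
Qed.

Lemma rip_zero_r y : rip y zero = 0.
Proof. rewrite rip_sym. apply rip_zero_l. Qed.

Lemma rip_opp_l x y : rip (opp x) y = - rip x y.
Proof.
  pose proof (rip_plus_l x (opp x) y) as h.
  rewrite (plus_opp_r x : plus x (opp x) = zero), rip_zero_l in h. lra.
Qed.

Lemma rip_opp_r x y : rip y (opp x) = - rip y x.
Proof. rewrite !(rip_sym y). apply rip_opp_l. Qed.

Lemma rip_minus_l x y z : rip (minus x y) z = rip x z - rip y z.
Proof. unfold minus. rewrite rip_plus_l, rip_opp_l. ring. Qed.

Lemma rip_minus_r x y z : rip z (minus x y) = rip z x - rip z y.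
Proof. unfold minus. rewrite rip_plus_r, rip_opp_r. ring. Qed.

(** The Cauchy-Schwarz inequality, read off the triangle inequality for the norm. *)
Lemma rip_le x y : rip x y <= norm x * norm y.
Proof.
  pose proof (hnorm_triangle x y) as h.
  pose proof (hnorm_ge_0 (plus x y)) as h0.
  assert (h1 : norm (plus x y) ^ 2 <= (norm x + norm y) ^ 2) by (apply pow_incr; lra).
  rewrite <- rip_self, rip_plus_l, !rip_plus_r, !rip_self, (rip_sym y x) in h1.
  simpl in h1. nra.
Qed.

Lemma Rabs_rip_le x y : Rabs (rip x y) <= norm x * norm y.
Proof.
  apply Rabs_le. split; [|apply rip_le].
  pose proof (rip_le (opp x) y) as h. rewrite rip_opp_l, hnorm_opp in h. lra.
Qed.

Lemma rip_eq x y : (forall z, rip x z = rip y z) -> x = y.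
Proof.
  intros h. specialize (h (minus x y)).
  assert (h0 : norm (minus x y) = 0).
  { apply Rsqr_0_uniq. rewrite Rsqr_pow2, <- rip_self, rip_minus_l. lra. }
  apply hnorm_eq_zero in h0. apply (plus_reg_r (G := H) (opp y)).
  transitivity (zero : H); [exact h0|symmetry; exact (plus_opp_r y)].
Qed.

Lemma bop_eq_rip S T : (forall x y, rip (S x) y = rip (T x) y) -> S = T.
Proof. intros h. apply bop_eq. intros x. apply rip_eq. intros y. apply h. Qed.

Lemma bop_morph_opp T x : T (opp x) = opp (T x).
Proof. apply rip_eq. intros z. rewrite rip_opp_l.
  pose proof (f_equal (fun u => rip u z) (bop_morph_plus T x (opp x))) as h.
  simpl in h. rewrite (plus_opp_r x : plus x (opp x) = zero), bop_morph_zero,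
    rip_plus_l, rip_zero_l in h. lra.
Qed.

Lemma bop_morph_minus T x y : T (minus x y) = minus (T x) (T y).
Proof.
  transitivity (plus (T x) (T (opp y))); [exact (bop_morph_plus T x (opp y))|].
  now rewrite bop_morph_opp.
Qed.

Lemma bop_plusE S T x : (S + T)%bop x = plus (S x) (T x).
Proof. reflexivity. Qed.
Lemma bop_minusE S T x : (S - T)%bop x = minus (S x) (T x).
Proof. reflexivity. Qed.
Lemma bop_oppE T x : (opp T : boundedOp H) x = opp (T x).
Proof. reflexivity. Qed.
Lemma bop_scalE a T x : (a *: T)%bop x = scal (RtoC a) (T x).
Proof. reflexivity. Qed.
Lemma bop_compE S T x : (S * T)%bop x = S (T x).
Proof. reflexivity. Qed.
Lemma bop_idE x : bop_id x = x.
Proof. reflexivity. Qed.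
Lemma bop_zeroE x : (zero : boundedOp H) x = zero.
Proof. reflexivity. Qed.
End Hilbert.

(** An identity between operators built from sums, real multiples and products is an
identity between the numbers [rip (S x) y]. Pushing all operations outwards turns it
into a polynomial identity in numbers [rip (A (B x)) y], where [ring] applies; the
noncommutative products remain inside the atoms. The type ascriptions allow for the
different but convertible paths by which the algebraic structures are inferred. *)
Ltac bop_push := match goal with
  | |- context [@bop_fun ?H (@plus ?G ?S ?T) ?x] =>
      rewrite (bop_plusE S T x : @bop_fun H (@plus G S T) x = _)
  | |- context [@bop_fun ?H (@minus ?G ?S ?T) ?x] =>
      rewrite (bop_minusE S T x : @bop_fun H (@minus G S T) x = _)
  | |- context [@bop_fun ?H (@opp ?G ?T) ?x] =>
      rewrite (bop_oppE T x : @bop_fun H (@opp G T) x = _)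
  | |- context [@bop_fun ?H (@scal ?K ?G ?a ?T) ?x] =>
      rewrite (bop_scalE a T x : @bop_fun H (@scal K G a T) x = _)
  | |- context [@bop_fun ?H (@zero ?G) ?x] =>
      rewrite (bop_zeroE x : @bop_fun H (@zero G) x = _)
  | |- context [@bop_fun ?H (@bop_comp _ ?S ?T) ?x] => rewrite (bop_compE S T x)
  | |- context [@bop_fun ?H bop_id ?x] => rewrite (bop_idE x)
  | |- context [@bop_fun ?H ?T (@plus ?G ?x ?y)] =>
      rewrite (bop_morph_plus T x y : @bop_fun H T (@plus G x y) = _)
  | |- context [@bop_fun ?H ?T (@minus ?G ?x ?y)] =>
      rewrite (bop_morph_minus T x y : @bop_fun H T (@minus G x y) = _)
  | |- context [@bop_fun ?H ?T (@opp ?G ?x)] =>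
      rewrite (bop_morph_opp T x : @bop_fun H T (@opp G x) = _)
  | |- context [@bop_fun ?H ?T (@scal ?K ?G ?a ?x)] =>
      rewrite (bop_morph_scal T a x : @bop_fun H T (@scal K G a x) = _)
  | |- context [@bop_fun ?H ?T (@zero ?G)] =>
      rewrite (bop_morph_zero T : @bop_fun H T (@zero G) = _)
  | |- context [@rip ?H (@plus ?G ?x ?y) ?z] =>
      rewrite (rip_plus_l x y z : @rip H (@plus G x y) z = _)
  | |- context [@rip ?H (@minus ?G ?x ?y) ?z] =>
      rewrite (rip_minus_l x y z : @rip H (@minus G x y) z = _)
  | |- context [@rip ?H (@opp ?G ?x) ?z] =>
      rewrite (rip_opp_l x z : @rip H (@opp G x) z = _)
  | |- context [@rip ?H (@scal ?K ?G (RtoC ?a) ?x) ?z] =>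
      rewrite (rip_scal_l a x z : @rip H (@scal K G (RtoC a) x) z = _)
  | |- context [@rip ?H (@zero ?G) ?z] =>
      rewrite (rip_zero_l z : @rip H (@zero G) z = _)
  | |- context [@rip ?H ?z (@plus ?G ?x ?y)] =>
      rewrite (rip_plus_r x y z : @rip H z (@plus G x y) = _)
  | |- context [@rip ?H ?z (@minus ?G ?x ?y)] =>
      rewrite (rip_minus_r x y z : @rip H z (@minus G x y) = _)
  | |- context [@rip ?H ?z (@opp ?G ?x)] =>
      rewrite (rip_opp_r x z : @rip H z (@opp G x) = _)
  | |- context [@rip ?H ?z (@scal ?K ?G (RtoC ?a) ?x)] =>
      rewrite (rip_scal_r a z x : @rip H z (@scal K G (RtoC a) x) = _)
  | |- context [@rip ?H ?z (@zero ?G)] =>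
      rewrite (rip_zero_r z : @rip H z (@zero G) = _)
  end.
Ltac bop_push_all := repeat bop_push.
Ltac bop_ring := apply bop_eq_rip; let x := fresh "x" in let y := fresh "y" in
  intros x y; bop_push_all; ring.

(** * Operator norm, inverses and the Neumann series *)

Section Norm.
Context {H : hilbertSpace}.
Implicit Types (x y z : H) (S T A B : boundedOp H).

Lemma bop_norm_ge_0 T : 0 <= bop_norm T.
Proof.
  eapply Rle_trans; [apply (hnorm_ge_0 (T zero))|]. apply bop_norm_unit.
  rewrite hnorm_zero. lra.
Qed.

Lemma bop_norm_bound_mult T m : 0 <= m ->
  (forall x, norm (T x) <= m * norm x) -> bop_norm T <= m.
Proof.
  intros hm h. apply bop_norm_bound. intros x hx. specialize (h x).
  pose proof (hnorm_ge_0 x). nra.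
Qed.

Lemma bop_norm_comp S T : bop_norm (S * T)%bop <= bop_norm S * bop_norm T.
Proof.
  pose proof (bop_norm_ge_0 S). pose proof (bop_norm_ge_0 T).
  apply bop_norm_bound_mult; [nra|]. intros x. rewrite bop_compE.
  eapply Rle_trans; [apply bop_norm_le|]. rewrite Rmult_assoc.
  apply Rmult_le_compat_l; [lra|apply bop_norm_le].
Qed.

Lemma bop_norm_id : bop_norm (bop_id : boundedOp H) <= 1.
Proof. apply bop_norm_bound. intros x hx. exact hx. Qed.

Lemma bop_norm_opp T : bop_norm (opp T) = bop_norm T.
Proof.
  apply Rle_antisym; apply bop_norm_bound; intros x hx.
  - rewrite bop_oppE, hnorm_opp. now apply bop_norm_unit.
  - rewrite <- hnorm_opp. now apply (bop_norm_unit (opp T)).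
Qed.

Lemma bop_norm_minus_comm S T : bop_norm (S - T)%bop = bop_norm (T - S)%bop.
Proof. rewrite <- bop_norm_opp. f_equal. bop_ring. Qed.

Lemma bop_norm_minus_le S T : bop_norm (S - T)%bop <= bop_norm S + bop_norm T.
Proof. rewrite <- (bop_norm_opp T). apply bop_norm_triangle. Qed.

Lemma bop_norm_small_eq S T :
  (forall e, 0 < e -> bop_norm (S - T)%bop <= e) -> S = T.
Proof.
  intros h. assert (h0 : bop_norm (S - T)%bop = 0).
  { apply Rle_antisym; [|apply bop_norm_ge_0].
    apply Rnot_lt_le. intros h1. specialize (h (bop_norm (S - T)%bop / 2)). lra. }
  apply bop_norm_eq0 in h0.
  transitivity ((S - T) + T)%bop; [bop_ring|]. rewrite h0. bop_ring.
Qed.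

Lemma bop_filterlim {X : Type} (F : (X -> Prop) -> Prop) {FF : Filter F}
  (f : X -> boundedOp H) L :
  filterlim f F (locally L) <->
  forall e : posreal, F (fun i => bop_norm (f i - L)%bop < e).
Proof. apply (filterlim_locally (U := bop_UniformSpace)). Qed.

Lemma bop_filterlim_sandwich {X : Type} (F : (X -> Prop) -> Prop) {FF : Filter F}
  (f : X -> boundedOp H) A B L : filterlim f F (locally L) ->
  filterlim (fun i => A * f i * B)%bop F (locally (A * L * B)%bop).
Proof.
  intros h0. pose proof (proj1 (bop_filterlim F f L) h0) as h.
  apply (bop_filterlim F). intros e.
  pose proof (bop_norm_ge_0 A). pose proof (bop_norm_ge_0 B).
  assert (d0 : 0 < e / (bop_norm A * bop_norm B + 1)).
  { apply Rdiv_lt_0_compat; [apply cond_pos|nra]. }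
  apply filter_imp with (2 := h (mkposreal _ d0)). simpl. intros x hx.
  replace (A * f x * B - A * L * B)%bop with (A * (f x - L) * B)%bop by bop_ring.
  eapply Rle_lt_trans; [apply bop_norm_comp|].
  apply Rle_lt_trans with (bop_norm A * bop_norm (f x - L)%bop * bop_norm B).
  { apply Rmult_le_compat_r; [lra|apply bop_norm_comp]. }
  pose proof (bop_norm_ge_0 (f x - L)%bop).
  apply Rle_lt_trans with ((bop_norm A * bop_norm B + 1) * bop_norm (f x - L)%bop); [nra|].
  apply Rlt_div_r in hx; nra.
Qed.

Lemma is_bop_inv_unique A S T : is_bop_inv A S -> is_bop_inv A T -> S = T.
Proof.
  intros [s1 s2] [t1 t2].
  transitivity (S * (A * T))%bop; [rewrite t2; bop_ring|].
  transitivity ((S * A) * T)%bop; [bop_ring|]. rewrite s1. bop_ring.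
Qed.

Lemma bop_inv_spec A : bop_invertible A -> is_bop_inv A (bop_inv A).
Proof. intros h. exact (epsilon_spec (inhabits (bop_zero : boundedOp H)) (is_bop_inv A) h). Qed.

Lemma bop_inv_eq A S : is_bop_inv A S -> bop_inv A = S.
Proof.
  intros h. apply (is_bop_inv_unique A); [|exact h]. apply bop_inv_spec. now exists S.
Qed.

Lemma bop_invertible_comp A B :
  bop_invertible A -> bop_invertible B -> bop_invertible (A * B)%bop.
Proof.
  intros [S [s1 s2]] [T [t1 t2]]. exists (T * S)%bop. split.
  - transitivity (T * (S * A) * B)%bop; [bop_ring|]. rewrite s1.
    transitivity (T * B)%bop; [bop_ring|exact t1].
  - transitivity (A * (B * T) * S)%bop; [bop_ring|]. rewrite t2.
    transitivity (A * S)%bop; [bop_ring|exact s2].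
Qed.

Lemma bop_invertible_scal (a : R) A : a <> 0 ->
  bop_invertible A -> bop_invertible (a *: A)%bop.
Proof.
  intros ha [S [s1 s2]]. exists (/ a *: S)%bop. split.
  - transitivity ((/ a * a) *: (S * A))%bop; [bop_ring|]. rewrite s1, Rinv_l by exact ha.
    bop_ring.
  - transitivity ((/ a * a) *: (A * S))%bop; [bop_ring|]. rewrite s2, Rinv_l by exact ha.
    bop_ring.
Qed.

(** Both one-sided inverses of [A] come from the inverse of the product, and they
agree. *)
Lemma bop_invertible_factor A B C : (A * B = C)%bop -> (B * A = C)%bop ->
  bop_invertible C -> bop_invertible A.
Proof.
  intros h1 h2 [S [s1 s2]].
  assert (l : (S * B * A = bop_id)%bop).
  { transitivity (S * (B * A))%bop; [bop_ring|]. now rewrite h2. }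
  assert (r : (A * (B * S) = bop_id)%bop).
  { transitivity (A * B * S)%bop; [bop_ring|]. now rewrite h1. }
  exists (B * S)%bop. split; [|exact r].
  replace (B * S)%bop with (S * B)%bop; [exact l|].
  transitivity (S * B * (A * (B * S)))%bop; [rewrite r; bop_ring|].
  transitivity (S * B * A * (B * S))%bop; [bop_ring|]. rewrite l. bop_ring.
Qed.

Fixpoint bop_pow A (n : nat) : boundedOp H :=
  match n with O => bop_id | S n => (A * bop_pow A n)%bop end.

Lemma bop_norm_pow A n : bop_norm (bop_pow A n) <= bop_norm A ^ n.
Proof.
  induction n as [|n IH]; simpl; [apply bop_norm_id|].
  eapply Rle_trans; [apply bop_norm_comp|].
  apply Rmult_le_compat_l; [apply bop_norm_ge_0|exact IH].
Qed.

Lemma bop_pow_comm A n : (bop_pow A n * A = A * bop_pow A n)%bop.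
Proof.
  induction n as [|n IH]; simpl; [bop_ring|].
  transitivity (A * (bop_pow A n * A))%bop; [bop_ring|]. now rewrite IH.
Qed.

(** The geometric series converges absolutely, and its partial sums invert
[1 - B] up to the power [B^(n+1)]. *)
Lemma neumann B : bop_norm B < 1 -> bop_invertible (bop_id - B)%bop.
Proof.
  intros hB. pose proof (bop_norm_ge_0 B) as hB0.
  assert (ex : ex_series (V := bop_NormedModule) (bop_pow B)).
  { apply (ex_series_le (V := bop_CompleteNormedModule) (bop_pow B) (fun n => bop_norm B ^ n)).
    - intros n. apply bop_norm_pow.
    - apply ex_series_geom. rewrite Rabs_pos_eq; lra. }
  destruct ex as [L hL]. unfold is_series in hL.
  set (s := sum_n (G := bop_AbelianMonoid) (bop_pow B)).
  assert (E1 : forall n, ((bop_id - B) * s n * bop_id = bop_id - bop_pow B (S n))%bop).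
  { unfold s. induction n as [|n IH].
    - rewrite sum_O. simpl. bop_ring.
    - rewrite sum_Sn. transitivity ((bop_id - B) * sum_n (G := bop_AbelianMonoid) (bop_pow B) n * bop_id
        + (bop_id - B) * bop_pow B (S n))%bop.
      { bop_ring. } rewrite IH. simpl. bop_ring. }
  assert (E2 : forall n, (bop_id * s n * (bop_id - B) = bop_id - bop_pow B (S n))%bop).
  { unfold s. induction n as [|n IH].
    - rewrite sum_O. simpl. bop_ring.
    - rewrite sum_Sn. transitivity (bop_id * sum_n (G := bop_AbelianMonoid) (bop_pow B) n * (bop_id - B)
        + bop_pow B (S n) - bop_pow B (S n) * B)%bop.
      { bop_ring. } rewrite IH, (bop_pow_comm B (S n)). simpl. bop_ring. }
  assert (P : filterlim (fun n => bop_id - bop_pow B (S n))%bop eventually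
     (locally (bop_id : boundedOp H))).
  { apply (bop_filterlim eventually). intros e.
    destruct (pow_lt_1_zero (bop_norm B) ltac:(rewrite Rabs_pos_eq; lra) e (cond_pos e)) as [N hN].
    exists N. intros n hn.
    replace (bop_id - bop_pow B (S n) - bop_id)%bop
      with (opp (bop_pow B (S n)) : boundedOp H) by bop_ring.
    rewrite bop_norm_opp. eapply Rle_lt_trans; [apply bop_norm_pow|].
    eapply Rle_lt_trans; [apply Rle_abs|]. apply hN. lia. }
  exists L. split.
  - apply (filterlim_locally_unique (F := eventually) (V := bop_NormedModule)
      (fun n => bop_id - bop_pow B (S n))%bop); [|exact P].
    apply filterlim_ext with (1 := E2).
    replace (L * (bop_id - B))%bop with (bop_id * L * (bop_id - B))%bop by bop_ring.
    exact (bop_filterlim_sandwich eventually s _ _ L hL).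
  - apply (filterlim_locally_unique (F := eventually) (V := bop_NormedModule)
      (fun n => bop_id - bop_pow B (S n))%bop); [|exact P].
    apply filterlim_ext with (1 := E1).
    replace ((bop_id - B) * L)%bop with ((bop_id - B) * L * bop_id)%bop by bop_ring.
    exact (bop_filterlim_sandwich eventually s _ _ L hL).
Qed.
End Norm.

(** * Symmetric and coercive operators *)

Section Positive.
Context {H : hilbertSpace}.
Implicit Types (x y z : H) (S T A B : boundedOp H).

Definition rsym A : Prop := forall x y, rip (A x) y = rip x (A y).

Definition coercive (m : R) A : Prop := forall x, m * norm x ^ 2 <= rip (A x) x.

(** The form in which positive invertible operators are used: a symmetric operator
with a positive lower bound. *)
Definition spd A : Prop := rsym A /\ exists m, 0 < m /\ coercive m A.

(** Polarization: the quadratic form is real at [x + i y], which compares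
[<T x, y>] with [<T y, x>]. *)
Lemma bop_pos_rsym T : bop_pos T -> rsym T.
Proof.
  intros [h _] x y.
  assert (E : forall u v, Im (inner (T u) v) = - Im (inner (T v) u)).
  { intros u v. destruct (h u) as [_ hu]. destruct (h v) as [_ hv].
    destruct (h (plus u v)) as [_ huv].
    rewrite bop_morph_plus, inner_plus_l in huv.
    rewrite (inner_conj H (plus u v) (T u)), (inner_conj H (plus u v) (T v)),
      !inner_plus_l in huv.
    rewrite (inner_conj H (T u) u), (inner_conj H (T u) v),
      (inner_conj H (T v) u), (inner_conj H (T v) v) in huv.
    unfold Im, Cplus, Cconj in *; simpl in *. lra. }
  specialize (E x (scal Ci y)).
  rewrite bop_morph_scal, inner_scal_l in E.
  rewrite (inner_conj H (scal Ci y) (T x)), inner_scal_l in E.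
  rewrite (rip_sym x). unfold rip. rewrite (inner_conj H y (T x)).
  unfold Im, Re, Cconj, Cmult, Ci in *; simpl in *. lra.
Qed.

Lemma rsym_plus A B : rsym A -> rsym B -> rsym (A + B)%bop.
Proof. intros hA hB x y. bop_push_all. now rewrite hA, hB. Qed.

Lemma rsym_minus A B : rsym A -> rsym B -> rsym (A - B)%bop.
Proof. intros hA hB x y. bop_push_all. now rewrite hA, hB. Qed.

Lemma rsym_scal a A : rsym A -> rsym (a *: A)%bop.
Proof. intros hA x y. bop_push_all. now rewrite hA. Qed.

Lemma rsym_id : rsym bop_id.
Proof. intros x y. reflexivity. Qed.

Lemma rsym_sandwich A B : rsym A -> rsym B -> rsym (A * B * A)%bop.
Proof. intros hA hB x y. bop_push_all. now rewrite hA, hB, hA. Qed.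

Lemma rsym_comp A B : rsym A -> rsym B -> (A * B = B * A)%bop -> rsym (A * B)%bop.
Proof.
  intros hA hB E x y. rewrite E at 1. rewrite !bop_compE. now rewrite hB, hA.
Qed.

Lemma rip_bop_norm A x : rip (A x) x <= bop_norm A * norm x ^ 2.
Proof.
  eapply Rle_trans; [apply rip_le|]. pose proof (bop_norm_le A x) as h.
  pose proof (hnorm_ge_0 x). simpl. nra.
Qed.

Lemma rip_bop_norm_lower A x : - (bop_norm A * norm x ^ 2) <= rip (A x) x.
Proof.
  pose proof (rip_bop_norm (opp A) x) as h. rewrite bop_norm_opp in h.
  revert h. bop_push_all. lra.
Qed.

(** Expand [<A y, y> >= 0] at [y = x - s A x] with [s = 1 / K]. *)
Lemma psd_image_norm A K : rsym A -> 0 < K ->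
  (forall x, 0 <= rip (A x) x <= K * norm x ^ 2) ->
  forall x, norm (A x) ^ 2 <= K * rip (A x) x.
Proof.
  intros hA hK h x.
  destruct (h (minus x (scal (RtoC (/ K)) (A x)))) as [h1 _].
  destruct (h (A x)) as [_ h2].
  revert h1. bop_push_all. rewrite (hA (A x) x), rip_self. intros h1.
  assert (hi : 0 < / K) by now apply Rinv_0_lt_compat.
  assert (h3 : / K * (/ K * rip (A (A x)) (A x)) <= / K * (/ K * (K * norm (A x) ^ 2))).
  { apply Rmult_le_compat_l; [lra|]. apply Rmult_le_compat_l; lra. }
  replace (/ K * (/ K * (K * norm (A x) ^ 2))) with (/ K * norm (A x) ^ 2) in h3 by (field; lra).
  assert (h4 : / K * norm (A x) ^ 2 <= rip (A x) x) by lra.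
  apply (Rmult_le_compat_l K) in h4; [|lra].
  rewrite <- Rmult_assoc, Rinv_r, Rmult_1_l in h4 by lra. exact h4.
Qed.

Lemma psd_norm A K : rsym A -> 0 < K ->
  (forall x, 0 <= rip (A x) x <= K * norm x ^ 2) -> bop_norm A <= K.
Proof.
  intros hA hK h. apply bop_norm_bound_mult; [lra|]. intros x.
  pose proof (psd_image_norm A K hA hK h x) as h1.
  pose proof (h x). pose proof (hnorm_ge_0 x). pose proof (hnorm_ge_0 (A x)).
  apply Rnot_lt_le. intros h2.
  assert (0 <= K * norm x) by nra.
  assert (norm (A x) ^ 2 <= (K * norm x) ^ 2) by (simpl in *; nra).
  simpl in *. nra.
Qed.

Lemma coercive_inverse_norm A B m : 0 < m -> coercive m A -> is_bop_inv A B ->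
  bop_norm B <= / m.
Proof.
  intros hm hA [_ h2]. apply bop_norm_bound_mult.
  { left. now apply Rinv_0_lt_compat. }
  intros x. specialize (hA (B x)).
  assert (E : A (B x) = x).
  { rewrite <- bop_compE, h2. reflexivity. }
  rewrite E in hA. pose proof (rip_le x (B x)) as h3.
  pose proof (hnorm_ge_0 x). pose proof (hnorm_ge_0 (B x)) as h4.
  rewrite Rmult_comm. apply Rle_div_r; [lra|].
  destruct h4 as [h4|h4]; [simpl in *; nra|rewrite <- h4; nra].
Qed.

(** For large [K] the operator [1 - A / K] has norm less than 1, so that the Neumann
series inverts [A / K]. *)
Lemma coercive_invertible A m : 0 < m -> rsym A -> coercive m A -> bop_invertible A.
Proof.
  intros hm hs hc. pose proof (bop_norm_ge_0 A) as hn.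
  set (K := bop_norm A + m + 1). assert (hK : 0 < K) by (unfold K; lra).
  assert (hmK : 0 < m / K < 1).
  { split; [now apply Rdiv_lt_0_compat|]. apply Rlt_div_l; unfold K in *; lra. }
  assert (hN : bop_norm (bop_id - / K *: A)%bop <= 1 - m / K).
  { apply psd_norm; [|lra|].
    - apply rsym_minus; [apply rsym_id|now apply rsym_scal].
    - intros x. bop_push_all. rewrite rip_self.
      pose proof (rip_bop_norm A x) as h1. specialize (hc x).
      assert (0 <= norm x ^ 2) by apply pow2_ge_0.
      assert (hi : 0 < / K) by now apply Rinv_0_lt_compat.
      split.
      + assert (h2 : / K * rip (A x) x <= / K * (K * norm x ^ 2)).
        { apply Rmult_le_compat_l; unfold K in *; nra. }
        rewrite <- Rmult_assoc, Rinv_l in h2 by lra. lra.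
      + assert (h2 : / K * (m * norm x ^ 2) <= / K * rip (A x) x)
          by (apply Rmult_le_compat_l; lra).
        unfold Rdiv. lra. }
  assert (hI : bop_invertible (bop_id - (bop_id - / K *: A))%bop) by (apply neumann; lra).
  replace A with (K *: (bop_id - (bop_id - / K *: A)))%bop.
  - apply bop_invertible_scal; [lra|exact hI].
  - apply bop_eq_rip. intros x y. bop_push_all. field. lra.
Qed.

Lemma invertible_lower_bound A : bop_invertible A ->
  exists c, 0 < c /\ forall x, c * norm x <= norm (A x).
Proof.
  intros [B [h1 _]]. pose proof (bop_norm_ge_0 B).
  exists (/ (bop_norm B + 1)). split; [apply Rinv_0_lt_compat; lra|].
  intros x. assert (E : B (A x) = x). { rewrite <- bop_compE, h1. reflexivity. }
  pose proof (bop_norm_le B (A x)) as h. rewrite E in h.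
  pose proof (hnorm_ge_0 (A x)).
  rewrite Rmult_comm. apply Rle_div_l; nra.
Qed.

(** An invertible operator is bounded below in norm, and for a positive one
[psd_image_norm] turns this into a lower bound of the quadratic form. *)
Lemma psd_invertible_coercive A : rsym A -> (forall x, 0 <= rip (A x) x) ->
  bop_invertible A -> exists m, 0 < m /\ coercive m A.
Proof.
  intros hs hp hi. destruct (invertible_lower_bound A hi) as [c [hc h]].
  pose proof (bop_norm_ge_0 A) as hn. set (K := bop_norm A + 1).
  exists (c ^ 2 / K). assert (hK : 0 < K) by (unfold K; lra).
  split. { apply Rdiv_lt_0_compat; [now apply pow_lt|exact hK]. }
  intros x. assert (h1 : norm (A x) ^ 2 <= K * rip (A x) x).
  { apply psd_image_norm; [exact hs|exact hK|]. intros y. split; [apply hp|].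
    pose proof (rip_bop_norm A y). pose proof (pow2_ge_0 (norm y)). unfold K. nra. }
  specialize (h x). pose proof (hnorm_ge_0 x).
  assert (h2 : (c * norm x) ^ 2 <= norm (A x) ^ 2).
  { apply pow_incr. split; [nra|exact h]. }
  apply Rle_trans with (/ K * (c * norm x) ^ 2); [right; field; lra|].
  rewrite Rmult_comm. apply Rle_div_l; [lra|]. lra.
Qed.

Lemma bop_pos_spd T : bop_pos T -> spd T.
Proof.
  intros h. pose proof (bop_pos_rsym T h) as hs. split; [exact hs|].
  apply psd_invertible_coercive; [exact hs| |exact (proj2 h)].
  intros x. apply (proj1 h x).
Qed.

Lemma spd_invertible A : spd A -> bop_invertible A.
Proof. intros [hs [m [hm hc]]]. now apply (coercive_invertible A m). Qed.

Lemma rsym_square_norm A x : rsym A -> rip ((A * A)%bop x) x = norm (A x) ^ 2.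
Proof. intros hA. rewrite bop_compE, hA. apply rip_self. Qed.
End Positive.

(** * Polynomials in a symmetric operator and its spectrum *)

Fixpoint poly_add (p q : list R) : list R :=
  match p, q with
  | nil, _ => q
  | _, nil => p
  | a :: p, b :: q => (a + b) :: poly_add p q
  end.

Definition poly_cmul (c : R) (p : list R) : list R := map (Rmult c) p.

Fixpoint poly_mul (p q : list R) : list R :=
  match p with
  | nil => nil
  | a :: p => poly_add (poly_cmul a q) (0 :: poly_mul p q)
  end.

Section Poly.
Context {H : hilbertSpace}.
Implicit Types (x y z : H) (S T A B : boundedOp H).

Lemma bop_poly_cons a p T :
  bop_poly (a :: p) T = (a *: bop_id + T * bop_poly p T)%bop.
Proof. reflexivity. Qed.

Lemma poly_eval_cons a p t : poly_eval (a :: p) t = a + t * poly_eval p t.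
Proof. reflexivity. Qed.

Lemma poly_eval_add p q t : poly_eval (poly_add p q) t = poly_eval p t + poly_eval q t.
Proof.
  revert q; induction p as [|a p IH]; intros q; [simpl; ring|].
  destruct q as [|b q]; [simpl; ring|]. simpl poly_add.
  rewrite !poly_eval_cons, IH. ring.
Qed.

Lemma bop_poly_add p q T : (bop_poly (poly_add p q) T = bop_poly p T + bop_poly q T)%bop.
Proof.
  revert q; induction p as [|a p IH]; intros q.
  - simpl. bop_ring.
  - destruct q as [|b q]; [simpl; bop_ring|]. simpl poly_add.
    rewrite !bop_poly_cons, IH. bop_ring.
Qed.

Lemma poly_eval_cmul c p t : poly_eval (poly_cmul c p) t = c * poly_eval p t.
Proof.
  induction p as [|a p IH]; [simpl; ring|]. unfold poly_cmul in *. simpl map.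
  rewrite !poly_eval_cons, IH. ring.
Qed.

Lemma bop_poly_cmul c p T : (bop_poly (poly_cmul c p) T = c *: bop_poly p T)%bop.
Proof.
  induction p as [|a p IH]; [simpl; bop_ring|]. unfold poly_cmul in *. simpl map.
  rewrite !bop_poly_cons, IH. bop_ring.
Qed.

Lemma poly_eval_mul p q t : poly_eval (poly_mul p q) t = poly_eval p t * poly_eval q t.
Proof.
  induction p as [|a p IH]; [simpl; ring|]. simpl poly_mul.
  rewrite poly_eval_add, poly_eval_cmul, !poly_eval_cons, IH. ring.
Qed.

Lemma bop_poly_mul p q T : (bop_poly (poly_mul p q) T = bop_poly p T * bop_poly q T)%bop.
Proof.
  induction p as [|a p IH]; [simpl; bop_ring|]. simpl poly_mul.
  rewrite bop_poly_add, bop_poly_cmul, !bop_poly_cons, IH. bop_ring.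
Qed.

Lemma bop_poly_comm p T A : (A * T = T * A)%bop ->
  (A * bop_poly p T = bop_poly p T * A)%bop.
Proof.
  intros h. induction p as [|a p IH]; [simpl; bop_ring|].
  rewrite !bop_poly_cons.
  transitivity (a *: A + (A * T) * bop_poly p T)%bop; [bop_ring|].
  rewrite h. transitivity (a *: A + T * (A * bop_poly p T))%bop; [bop_ring|].
  rewrite IH. bop_ring.
Qed.

Lemma rsym_poly p T : rsym T -> rsym (bop_poly p T).
Proof.
  intros h. induction p as [|a p IH].
  - intros x y. simpl. now rewrite rip_zero_l, rip_zero_r.
  - rewrite bop_poly_cons. apply rsym_plus; [apply rsym_scal, rsym_id|].
    apply rsym_comp; [exact h|exact IH|]. now apply bop_poly_comm.
Qed.

Lemma poly_factor_linear p a : exists q r, length q = pred (length p) /\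
  (forall t, poly_eval p t = (t - a) * poly_eval q t + r) /\
  forall T, (bop_poly p T = (T - a *: bop_id) * bop_poly q T + r *: bop_id)%bop.
Proof.
  induction p as [|c p [q [r [hl [h1 h2]]]]].
  - exists nil, 0. simpl. repeat split; intros; [ring|bop_ring].
  - destruct p as [|b p].
    + exists nil, c. simpl. repeat split; intros; [ring|bop_ring].
    + exists (r :: q), (c + a * r). split; [simpl in *; lia|]. split.
      * intros t. rewrite poly_eval_cons, h1, poly_eval_cons. ring.
      * intros T. rewrite bop_poly_cons, h2, bop_poly_cons. bop_ring.
Qed.

(** Division by [(X - a)^2 + b^2]. The three identities share one quotient and
remainder; the complex one shows that the remainder vanishes when [a + i b] is a
root. *)
Lemma poly_factor_quadratic p a b : exists q r s, (length q = length p - 2)%nat /\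
  (forall t, poly_eval p t = ((t - a) ^ 2 + b ^ 2) * poly_eval q t + (r * t + s)) /\
  (forall z : C, cpoly_eval p z =
     ((z - RtoC a) * (z - RtoC a) + RtoC b * RtoC b) * cpoly_eval q z
     + (RtoC r * z + RtoC s))%C /\
  forall T, (bop_poly p T =
    ((T - a *: bop_id) * (T - a *: bop_id) + (b * b)%R *: bop_id) * bop_poly q T
    + (r *: T + s *: bop_id))%bop.
Proof.
  induction p as [|c p [q [r [s [hl [h1 [h2 h3]]]]]]].
  - exists nil, 0, 0. simpl. repeat split; intros; [ring|ring|bop_ring].
  - destruct p as [|c1 [|c2 p]].
    + exists nil, 0, c. simpl. repeat split; intros; [ring|ring|bop_ring].
    + exists nil, c1, c. simpl. repeat split; intros; [ring|ring|bop_ring].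
    + exists (r :: q), (2 * a * r + s), (c - r * (a * a + b * b)).
      split; [simpl in *; lia|]. split; [|split].
      * intros t. rewrite poly_eval_cons, h1, poly_eval_cons. ring.
      * intros z. transitivity (RtoC c + z * cpoly_eval (c1 :: c2 :: p) z)%C; [reflexivity|].
        rewrite h2. change (cpoly_eval (r :: q) z) with (RtoC r + z * cpoly_eval q z)%C.
        rewrite RtoC_minus, !RtoC_plus, !RtoC_mult, RtoC_plus, !RtoC_mult. ring.
      * intros T. rewrite bop_poly_cons, h3, bop_poly_cons. bop_ring.
Qed.

Lemma bop_poly_const c T : (bop_poly (c :: nil) T = c *: bop_id)%bop.
Proof. simpl. bop_ring. Qed.

Lemma poly_snoc0 p : (forall t, poly_eval (p ++ 0 :: nil) t = poly_eval p t) /\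
  forall T, bop_poly (p ++ 0 :: nil) T = bop_poly p T.
Proof.
  induction p as [|a p [h1 h2]]; split.
  - intros t. simpl. ring.
  - intros T. simpl. bop_ring.
  - intros t. rewrite <- app_comm_cons, !poly_eval_cons, h1. ring.
  - intros T. rewrite <- app_comm_cons, !bop_poly_cons, h2. reflexivity.
Qed.

Lemma bop_cscal_id (a : R) : bop_cscal (RtoC a) bop_id = (a *: (bop_id : boundedOp H))%bop.
Proof. reflexivity. Qed.

Lemma cpoly_eval_real p (t : R) : cpoly_eval p (RtoC t) = RtoC (poly_eval p t).
Proof.
  induction p as [|a p IH]; [reflexivity|].
  transitivity (RtoC a + RtoC t * cpoly_eval p (RtoC t))%C; [reflexivity|].
  rewrite IH, poly_eval_cons, RtoC_plus, RtoC_mult. reflexivity.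
Qed.

Lemma quadratic_invertible T a b : rsym T -> b <> 0 ->
  bop_invertible
    ((T - a *: bop_id) * (T - a *: bop_id) + (b * b)%R *: bop_id)%bop.
Proof.
  intros hT hb.
  assert (hs : rsym (T - a *: bop_id)%bop).
  { apply rsym_minus; [exact hT|]. apply rsym_scal, rsym_id. }
  apply (coercive_invertible _ (b * b)).
  - nra.
  - apply rsym_plus; [now apply rsym_comp|apply rsym_scal, rsym_id].
  - intros x. rewrite bop_plusE, rip_plus_l, rsym_square_norm by exact hs.
    pose proof (pow2_ge_0 (norm ((T - a *: bop_id)%bop x))).
    rewrite bop_scalE, rip_scal_l, bop_idE, rip_self. lra.
Qed.

(** The part of the spectral mapping theorem that needs complex roots: if [p] is not
zero and no factor [T - a] of [p T] with [a] real is singular, then [p T] is a product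
of invertible factors, because the quadratic factors without real roots are bounded
below by [b^2]. *)
Lemma poly_noninvertible T p : rsym T -> ~ bop_invertible (bop_poly p T) ->
  (forall t, poly_eval p t = 0) \/ exists t, spectrum T (RtoC t) /\ poly_eval p t = 0.
Proof.
  intros hT. remember (length p) as n eqn:En.
  assert (hn : (length p <= n)%nat) by lia. clear En. revert p hn.
  induction n as [|n IH]; intros p hn hp.
  { left. destruct p; [reflexivity|simpl in hn; lia]. }
  destruct (list_eq_dec Req_dec_T p nil) as [->|hnil]; [left; reflexivity|].
  destruct (exists_last hnil) as [l [c ->]]. rewrite length_app in hn. simpl in hn.
  destruct (poly_snoc0 l) as [z1 z2].
  destruct (Req_dec c 0) as [->|hc].
  { rewrite z2 in hp. destruct (IH l ltac:(lia) hp) as [h|[t [h1 h2]]].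
    - left. intros t. now rewrite z1.
    - right. exists t. now rewrite z1. }
  destruct (list_eq_dec Req_dec_T l nil) as [->|hl].
  { exfalso. apply hp. simpl app. rewrite bop_poly_const.
    apply bop_invertible_scal; [exact hc|]. exists bop_id. split; bop_ring. }
  destruct (complex_root l c hl hc) as [[a b] hz].
  assert (len : length (l ++ c :: nil) = S (length l)) by (rewrite length_app; simpl; lia).
  set (p := (l ++ c :: nil)%list) in *.
  destruct (Req_dec b 0) as [->|hb].
  - destruct (poly_factor_linear p a) as [q [r [hq [h1 h2]]]].
    assert (hr : r = 0).
    { change (a, 0) with (RtoC a) in hz. rewrite cpoly_eval_real in hz.
      apply RtoC_inj in hz. rewrite h1 in hz. lra. }
    subst r.
    destruct (classic (bop_invertible (T - a *: bop_id)%bop)) as [hi|hi].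
    + destruct (IH q) as [h|[t [h3 h4]]].
      * lia.
      * intros hqi. apply hp. rewrite h2.
        replace (_ + 0 *: bop_id)%bop with ((T - a *: bop_id) * bop_poly q T)%bop by bop_ring.
        now apply bop_invertible_comp.
      * left. intros t. rewrite h1, h. ring.
      * right. exists t. split; [exact h3|]. rewrite h1, h4. ring.
    + right. exists a. split; [exact hi|]. rewrite h1. ring.
  - destruct (poly_factor_quadratic p a b) as [q [r [s [hq [h1 [h2 h3]]]]]].
    assert (hrs : r = 0 /\ s = 0).
    { rewrite h2 in hz.
      replace (((a, b) - RtoC a) * ((a, b) - RtoC a) + RtoC b * RtoC b)%C with (RtoC 0) in hz.
      2:{ unfold RtoC, Cminus, Cplus, Copp, Cmult; simpl. f_equal; ring. }
      rewrite Cmult_0_l, Cplus_0_l in hz.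
      unfold RtoC, Cplus, Cmult in hz; simpl in hz. injection hz as e1 e2.
      assert (r = 0) by (apply (Rmult_eq_reg_r b); lra). subst r. lra. }
    destruct hrs as [-> ->].
    destruct (IH q) as [h|[t [h4 h5]]].
    + lia.
    + intros hqi. apply hp. rewrite h3.
      match goal with |- bop_invertible (?X + _)%bop =>
        replace (X + _)%bop with X by bop_ring end.
      apply bop_invertible_comp; [|exact hqi]. now apply quadratic_invertible.
    + left. intros t. rewrite h1, h. ring.
    + right. exists t. split; [exact h4|]. rewrite h1, h5. ring.
Qed.

(** [p T - p t] is a multiple of [T - t], hence singular, whereas it would be
invertible by the Neumann series if [|p t|] exceeded the norm of [p T]. *)
Lemma poly_eval_le_norm T p t : spectrum T (RtoC t) ->
  Rabs (poly_eval p t) <= bop_norm (bop_poly p T).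
Proof.
  intros ht. apply Rnot_lt_le. intros h. apply ht.
  destruct (poly_factor_linear p t) as [q [r [_ [h1 h2]]]].
  assert (er : poly_eval p t = r) by (rewrite h1; ring). rewrite er in h.
  pose proof (bop_norm_ge_0 (bop_poly p T)) as h0.
  assert (hr : r <> 0).
  { intros ->. rewrite Rabs_R0 in h. lra. }
  assert (E : ((T - t *: bop_id) * (- / r *: bop_poly q T) = bop_id - / r *: bop_poly p T)%bop).
  { rewrite (h2 T). apply bop_eq_rip. intros x y. bop_push_all. field. exact hr. }
  assert (hc : (bop_poly q T * (T - t *: bop_id) = (T - t *: bop_id) * bop_poly q T)%bop).
  { symmetry. apply bop_poly_comm. bop_ring. }
  apply (bop_invertible_factor _ _ _ E).
  - rewrite <- E.
    transitivity (- / r *: (bop_poly q T * (T - t *: bop_id)))%bop; [bop_ring|].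
    rewrite hc. bop_ring.
  - apply neumann.
    eapply Rle_lt_trans; [apply (bop_norm_scal (/ r) (bop_poly p T))|].
    change (abs (/ r)) with (Rabs (/ r)). rewrite Rabs_inv.
    assert (0 < Rabs r) by now apply Rabs_pos_lt.
    rewrite Rmult_comm. apply Rlt_div_l; lra.
Qed.

(** With [N] the norm of [p T], the positive operator [N^2 - (p T)^2] is not
invertible, since a positive lower bound for it would make the norm of [p T] smaller
than [N]. So the polynomial [N^2 - p^2] has a zero in the spectrum, unless it is
identically zero. *)
Lemma norm_poly_noninvertible T p : rsym T ->
  bop_norm (bop_poly p T) <> 0 ->
  (forall t, Rabs (poly_eval p t) = bop_norm (bop_poly p T)) \/
  exists t, spectrum T (RtoC t) /\ Rabs (poly_eval p t) = bop_norm (bop_poly p T).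
Proof.
  intros hT h0. set (N := bop_norm (bop_poly p T)) in *.
  assert (hN : 0 < N) by (pose proof (bop_norm_ge_0 (bop_poly p T)); unfold N in *; lra).
  set (q := poly_add ((N * N) :: nil) (poly_cmul (-1) (poly_mul p p))).
  assert (e1 : forall t, poly_eval q t = N * N - poly_eval p t * poly_eval p t).
  { intros t. unfold q. rewrite poly_eval_add, poly_eval_cmul, poly_eval_mul. simpl. ring. }
  assert (e2 : (bop_poly q T = (N * N)%R *: bop_id - bop_poly p T * bop_poly p T)%bop).
  { unfold q. rewrite bop_poly_add, bop_poly_cmul, bop_poly_mul, bop_poly_const. bop_ring. }
  assert (hs : rsym (bop_poly p T)) by now apply rsym_poly.
  assert (e3 : forall x, rip (bop_poly q T x) x =
    N * N * norm x ^ 2 - norm (bop_poly p T x) ^ 2).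
  { intros x. rewrite e2. bop_push_all. now rewrite hs, !rip_self. }
  assert (hq : ~ bop_invertible (bop_poly q T)).
  { intros hi. destruct (psd_invertible_coercive (bop_poly q T)) as [m [hm hc]].
    - now apply rsym_poly.
    - intros x. rewrite e3.
      pose proof (bop_norm_le (bop_poly p T) x) as h1. fold N in h1.
      pose proof (hnorm_ge_0 x). pose proof (hnorm_ge_0 (bop_poly p T x)). simpl. nra.
    - exact hi.
    - (* The maximum keeps the square root meaningful when [m] exceeds [N * N]. *)
      set (K := Rmax 0 (N * N - m)).
      assert (hK : K < N * N) by (unfold K; apply Rmax_lub_lt; nra).
      assert (hb : N <= sqrt K).
      { apply bop_norm_bound_mult; [apply sqrt_pos|]. intros x. specialize (hc x).
        rewrite e3 in hc.
        pose proof (hnorm_ge_0 x). pose proof (hnorm_ge_0 (bop_poly p T x)).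
        rewrite <- (sqrt_pow2 (norm x)) by lra.
        rewrite <- (sqrt_pow2 (norm (bop_poly p T x))) by lra.
        rewrite <- sqrt_mult; [|apply Rmax_l|apply pow2_ge_0].
        apply sqrt_le_1_alt. pose proof (Rmax_r 0 (N * N - m)) as hr. fold K in hr.
        pose proof (pow2_ge_0 (norm x)). nra. }
      assert (sqrt K < N); [|lra].
      rewrite <- (sqrt_square N) by lra. apply sqrt_lt_1_alt. split; [apply Rmax_l|exact hK]. }
  assert (fin : forall t, poly_eval q t = 0 -> Rabs (poly_eval p t) = N).
  { intros t ht. rewrite e1 in ht.
    rewrite <- (Rabs_pos_eq N) by lra. apply Rsqr_eq_abs_0. unfold Rsqr. lra. }
  destruct (poly_noninvertible T q hT hq) as [h|[t [h1 h2]]].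
  - left. intros t. now apply fin.
  - right. exists t. split; [exact h1|now apply fin].
Qed.

Lemma spectrum_nonempty T : rsym T -> bop_norm (bop_id : boundedOp H) <> 0 ->
  exists t, spectrum T (RtoC t).
Proof.
  intros hT hI.
  destruct (Req_dec (bop_norm T) 0) as [h0|h0].
  - exists 0. intros [B [h1 _]]. apply bop_norm_eq0 in h0. apply hI.
    rewrite <- h1, h0, bop_cscal_id. etransitivity; [|exact (bop_norm_zero (H := H))]. f_equal. bop_ring.
  - assert (E : bop_poly (0 :: 1 :: nil) T = T) by (simpl; bop_ring).
    destruct (norm_poly_noninvertible T (0 :: 1 :: nil) hT) as [h|[t [h _]]].
    + now rewrite E.
    + rewrite E in h. pose proof (h 0) as h1. simpl in h1.
      exfalso. apply h0. rewrite <- h1. rewrite Rmult_0_l, Rplus_0_l. apply Rabs_R0.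
    + now exists t.
Qed.

(** Together with [poly_eval_le_norm]: the norm of [p T] is the supremum of [|p|]
over the spectrum. *)
Lemma bop_norm_poly_le T p e : rsym T -> 0 <= e ->
  (forall t, spectrum T (RtoC t) -> Rabs (poly_eval p t) <= e) ->
  bop_norm (bop_poly p T) <= e.
Proof.
  intros hT he h.
  destruct (Req_dec (bop_norm (bop_poly p T)) 0) as [h0|h0]; [lra|].
  destruct (norm_poly_noninvertible T p hT h0) as [h1|[t [h1 h2]]].
  - destruct (spectrum_nonempty T hT) as [t ht].
    + intros h2. apply h0.
      apply Rle_antisym; [|apply bop_norm_ge_0].
      apply Rle_trans with (bop_norm (bop_poly p T) * bop_norm (bop_id : boundedOp H));
        [|rewrite h2; lra].
      eapply Rle_trans; [|apply bop_norm_comp]. right. f_equal. bop_ring.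
    + rewrite <- (h1 t). now apply h.
  - rewrite <- h2. now apply h.
Qed.
End Poly.

(** * The functional calculus as an isometry *)

Section Calculus.
Context {H : hilbertSpace}.
Implicit Types (x y z : H) (S T A B : boundedOp H).

(** [S = f(T)] in the sense of [is_bop_fun], but with one approximating polynomial
for each error instead of a sequence; this avoids choosing sequences in the closure
properties below. *)
Definition fcalc T (f : R -> R) S : Prop := forall e, 0 < e -> exists p,
  (forall t, spectrum T (RtoC t) -> Rabs (poly_eval p t - f t) <= e) /\
  bop_norm (bop_poly p T - S)%bop <= e.

Lemma is_bop_fun_fcalc f T S : is_bop_fun f T S -> fcalc T f S.
Proof.
  intros [p [h1 h2]] e he.
  pose proof (proj1 (bop_filterlim eventually _ _) h2 (mkposreal e he)) as h3.
  destruct (filter_ex _ (filter_and _ _ (h1 (mkposreal e he)) h3)) as [n [h4 h5]].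
  simpl in h4, h5. exists (p n). split; [|lra].
  intros t ht. left. now apply h4.
Qed.

Lemma fcalc_is_bop_fun f T S : fcalc T f S -> is_bop_fun f T S.
Proof.
  intros h.
  pose (P := fun (n : nat) (p : list R) =>
    (forall t, spectrum T (RtoC t) -> Rabs (poly_eval p t - f t) <= / INR (n + 1)) /\
    bop_norm (bop_poly p T - S)%bop <= / INR (n + 1)).
  assert (hP : forall n, P n (epsilon (inhabits nil) (P n))).
  { intros n. apply epsilon_spec. apply h. apply Rinv_0_lt_compat, lt_0_INR. lia. }
  assert (small : forall e : posreal, eventually (fun n => / INR (n + 1) < e)).
  { intros e. destruct (archimed_cor1 e (cond_pos e)) as [N [hN hN0]].
    exists N. intros n hn. apply Rle_lt_trans with (2 := hN). apply Rinv_le_contravar.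
    - now apply lt_0_INR.
    - apply le_INR. lia. }
  exists (fun n => epsilon (inhabits nil) (P n)). split.
  - intros e. apply filter_imp with (2 := small e). intros n hn t ht.
    apply Rle_lt_trans with (2 := hn). now apply (hP n).
  - apply (bop_filterlim eventually). intros e.
    apply filter_imp with (2 := small e). intros n hn.
    apply Rle_lt_trans with (2 := hn). apply (hP n).
Qed.

(** [f(T)] depends on [f] isometrically for the supremum norm over the spectrum: this
lemma and [fcalc_eval] are the two inequalities. *)
Lemma fcalc_dist T f g S S' e : rsym T -> fcalc T f S -> fcalc T g S' -> 0 <= e ->
  (forall t, spectrum T (RtoC t) -> Rabs (f t - g t) <= e) -> bop_norm (S - S')%bop <= e.
Proof.
  intros hT hf hg he h. apply Rle_plus_epsilon. intros d hd.
  destruct (hf (d / 4) ltac:(lra)) as [p [p1 p2]].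
  destruct (hg (d / 4) ltac:(lra)) as [q [q1 q2]].
  set (pq := poly_add p (poly_cmul (-1) q)).
  assert (E : (bop_poly pq T = bop_poly p T - bop_poly q T)%bop).
  { unfold pq. rewrite bop_poly_add, bop_poly_cmul. bop_ring. }
  assert (h1 : bop_norm (bop_poly pq T) <= e + d / 2).
  { apply bop_norm_poly_le; [exact hT|lra|]. intros t ht.
    unfold pq. rewrite poly_eval_add, poly_eval_cmul.
    specialize (p1 t ht). specialize (q1 t ht). specialize (h t ht).
    apply Rabs_le_between in p1, q1, h. apply Rabs_le. lra. }
  replace (S - S')%bop with (bop_poly pq T + (bop_poly q T - S') - (bop_poly p T - S))%bop
    by (rewrite E; bop_ring).
  eapply Rle_trans; [apply bop_norm_minus_le|].
  assert (h2 : bop_norm (bop_poly pq T + (bop_poly q T - S'))%bop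
    <= bop_norm (bop_poly pq T) + bop_norm (bop_poly q T - S')%bop) by apply bop_norm_triangle.
  lra.
Qed.

Lemma fcalc_unique T f S S' : rsym T -> fcalc T f S -> fcalc T f S' -> S = S'.
Proof.
  intros hT h h'. apply bop_norm_small_eq. intros e he.
  apply (fcalc_dist T f f); try assumption; [lra|]. intros t _.
  rewrite Rminus_diag, Rabs_R0. lra.
Qed.

Lemma fcalc_eval T f g S S' t : fcalc T f S -> fcalc T g S' ->
  spectrum T (RtoC t) -> Rabs (f t - g t) <= bop_norm (S - S')%bop.
Proof.
  intros hf hg ht. apply Rle_plus_epsilon. intros d hd.
  destruct (hf (d / 4) ltac:(lra)) as [p [p1 p2]].
  destruct (hg (d / 4) ltac:(lra)) as [q [q1 q2]].
  set (pq := poly_add p (poly_cmul (-1) q)).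
  pose proof (poly_eval_le_norm T pq t ht) as h.
  unfold pq in h. rewrite poly_eval_add, poly_eval_cmul, bop_poly_add, bop_poly_cmul in h.
  replace (bop_poly p T + -1 *: bop_poly q T)%bop
    with ((S - S') + (bop_poly p T - S) - (bop_poly q T - S'))%bop in h by bop_ring.
  pose proof (bop_norm_minus_le ((S - S') + (bop_poly p T - S))%bop (bop_poly q T - S')%bop) as h1.
  assert (h2 : bop_norm ((S - S') + (bop_poly p T - S))%bop
    <= bop_norm (S - S')%bop + bop_norm (bop_poly p T - S)%bop) by apply bop_norm_triangle.
  specialize (p1 t ht). specialize (q1 t ht).
  apply Rabs_le_between in p1, q1.
  apply (Rle_trans _ _ _ h) in h1.
  apply Rabs_le_between in h1. apply Rabs_le. lra.
Qed.

Lemma fcalc_ext T f g S : (forall t, spectrum T (RtoC t) -> f t = g t) ->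
  fcalc T f S -> fcalc T g S.
Proof.
  intros h hf e he. destruct (hf e he) as [p [p1 p2]]. exists p. split; [|exact p2].
  intros t ht. rewrite <- h by exact ht. now apply p1.
Qed.

Lemma fcalc_poly T p : fcalc T (poly_eval p) (bop_poly p T).
Proof.
  intros e he. exists p. split.
  - intros t _. rewrite Rminus_diag, Rabs_R0. lra.
  - rewrite bop_norm_minus_diag. lra.
Qed.

Lemma fcalc_const T c : fcalc T (fun _ => c) (c *: bop_id)%bop.
Proof.
  rewrite <- (bop_poly_const c T). apply fcalc_ext with (poly_eval (c :: nil)).
  - intros t _. simpl. ring.
  - apply fcalc_poly.
Qed.

Lemma fcalc_id T : fcalc T (fun t => t) T.
Proof.
  replace T with (bop_poly (0 :: 1 :: nil) T) at 2 by (simpl; bop_ring).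
  apply fcalc_ext with (poly_eval (0 :: 1 :: nil)).
  - intros t _. simpl. ring.
  - apply fcalc_poly.
Qed.

Lemma fcalc_plus T f g A B : fcalc T f A -> fcalc T g B ->
  fcalc T (fun t => f t + g t) (A + B)%bop.
Proof.
  intros hf hg e he.
  destruct (hf (e / 2) ltac:(lra)) as [p [p1 p2]].
  destruct (hg (e / 2) ltac:(lra)) as [q [q1 q2]].
  exists (poly_add p q). split.
  - intros t ht. rewrite poly_eval_add. specialize (p1 t ht). specialize (q1 t ht).
    apply Rabs_le_between in p1, q1. apply Rabs_le. lra.
  - rewrite bop_poly_add.
    replace (bop_poly p T + bop_poly q T - (A + B))%bop
      with ((bop_poly p T - A) + (bop_poly q T - B))%bop by bop_ring.
    eapply Rle_trans; [apply bop_norm_triangle|]. lra.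
Qed.

Lemma fcalc_bounded T f A t : fcalc T f A -> spectrum T (RtoC t) -> Rabs (f t) <= bop_norm A.
Proof.
  intros hf ht. pose proof (fcalc_eval T f (fun _ => 0) A _ t hf (fcalc_const T 0) ht) as h.
  rewrite Rminus_0_r in h. replace (A - 0 *: bop_id)%bop with A in h by bop_ring. exact h.
Qed.

Lemma fcalc_mult T f g A B : fcalc T f A -> fcalc T g B ->
  fcalc T (fun t => f t * g t) (A * B)%bop.
Proof.
  intros hf hg e he.
  pose proof (bop_norm_ge_0 A) as hA. pose proof (bop_norm_ge_0 B) as hB.
  set (d := Rmin 1 (e / (bop_norm A + bop_norm B + 1))).
  assert (hd0 : 0 < d) by (apply Rmin_glb_lt; [lra|apply Rdiv_lt_0_compat; lra]).
  assert (hd1 : d <= 1) by apply Rmin_l.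
  assert (hd2 : (bop_norm A + bop_norm B + 1) * d <= e).
  { rewrite Rmult_comm. apply Rle_div_r; [lra|apply Rmin_r]. }
  assert (key : forall a b u v, 0 <= a -> 0 <= b -> 0 <= u -> 0 <= v ->
    u <= bop_norm A + d -> v <= d -> a <= d -> b <= bop_norm B -> u * v + a * b <= e).
  { intros.
    apply Rle_trans with ((bop_norm A + d) * d + d * bop_norm B).
    - apply Rplus_le_compat; apply Rmult_le_compat; lra.
    - nra. }
  destruct (hf d hd0) as [p [p1 p2]]. destruct (hg d hd0) as [q [q1 q2]].
  exists (poly_mul p q). split.
  - intros t ht. rewrite poly_eval_mul.
    pose proof (fcalc_bounded T f A t hf ht) as bf. pose proof (fcalc_bounded T g B t hg ht) as bg.
    specialize (p1 t ht). specialize (q1 t ht).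
    replace (poly_eval p t * poly_eval q t - f t * g t) with
      (poly_eval p t * (poly_eval q t - g t) + (poly_eval p t - f t) * g t) by ring.
    eapply Rle_trans; [apply Rabs_triang|]. rewrite !Rabs_mult.
    assert (Rabs (poly_eval p t) <= bop_norm A + d).
    { replace (poly_eval p t) with (f t + (poly_eval p t - f t)) by ring.
      eapply Rle_trans; [apply Rabs_triang|]. lra. }
    apply key; try assumption; apply Rabs_pos.
  - rewrite bop_poly_mul.
    replace (bop_poly p T * bop_poly q T - A * B)%bop with
      (bop_poly p T * (bop_poly q T - B) + (bop_poly p T - A) * B)%bop by bop_ring.
    eapply Rle_trans; [apply bop_norm_triangle|].
    eapply Rle_trans; [apply Rplus_le_compat; apply bop_norm_comp|].
    assert (bop_norm (bop_poly p T) <= bop_norm A + d).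
    { replace (bop_poly p T) with (A + (bop_poly p T - A))%bop by bop_ring.
      eapply Rle_trans; [apply bop_norm_triangle|]. lra. }
    apply key; try assumption; try apply bop_norm_ge_0. lra.
Qed.

Lemma fcalc_scal T c f A : fcalc T f A -> fcalc T (fun t => c * f t) (c *: A)%bop.
Proof.
  intros hf. replace (c *: A)%bop with (c *: bop_id * A)%bop by bop_ring.
  apply (fcalc_mult T (fun _ => c)); [apply fcalc_const|exact hf].
Qed.

Lemma fcalc_limit T f S :
  (forall e, 0 < e -> exists g A, fcalc T g A /\
    (forall t, spectrum T (RtoC t) -> Rabs (g t - f t) <= e) /\
    bop_norm (A - S)%bop <= e) -> fcalc T f S.
Proof.
  intros h e he. destruct (h (e / 2) ltac:(lra)) as [g [A [hg [h1 h2]]]].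
  destruct (hg (e / 2) ltac:(lra)) as [p [p1 p2]]. exists p. split.
  - intros t ht. specialize (h1 t ht). specialize (p1 t ht).
    apply Rabs_le_between in p1, h1. apply Rabs_le. lra.
  - replace (bop_poly p T - S)%bop with ((bop_poly p T - A) + (A - S))%bop by bop_ring.
    eapply Rle_trans; [apply bop_norm_triangle|]. lra.
Qed.

Lemma rsym_fcalc T f S : rsym T -> fcalc T f S -> rsym S.
Proof.
  intros hT hf x y. apply cond_eq. intros e he.
  pose proof (hnorm_ge_0 x) as hx. pose proof (hnorm_ge_0 y) as hy.
  set (d := e / (2 * (norm x * norm y) + 1)).
  assert (hd : 0 < d) by (apply Rdiv_lt_0_compat; nra).
  destruct (hf d hd) as [p [_ p2]].
  pose proof (rsym_poly p T hT x y) as hs.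
  assert (b : forall u v, Rabs (rip ((bop_poly p T - S)%bop u) v) <= d * (norm u * norm v)).
  { intros u v. eapply Rle_trans; [apply Rabs_rip_le|].
    pose proof (bop_norm_le (bop_poly p T - S)%bop u) as h.
    pose proof (hnorm_ge_0 u). pose proof (hnorm_ge_0 v).
    rewrite <- Rmult_assoc. apply Rmult_le_compat_r; [lra|]. nra. }
  pose proof (b x y) as b1. pose proof (b y x) as b2.
  revert b1 b2. bop_push_all. rewrite (rip_sym _ x), (rip_sym (S y) x), (Rmult_comm (norm y)).
  rewrite <- hs. intros b1 b2.
  assert (hde : 2 * (d * (norm x * norm y)) < e).
  { replace e with (d * (2 * (norm x * norm y) + 1)) by (unfold d; field; nra). lra. }
  apply Rabs_le_between in b1, b2. apply Rabs_def1; lra.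
Qed.

Lemma spectrum_ge T m t : rsym T -> coercive m T -> spectrum T (RtoC t) -> m <= t.
Proof.
  intros hT hm ht. apply Rnot_lt_le. intros h. apply ht. rewrite bop_cscal_id.
  apply (coercive_invertible _ (m - t)); [lra| |].
  - apply rsym_minus; [exact hT|apply rsym_scal, rsym_id].
  - intros x. specialize (hm x). bop_push_all. rewrite rip_self. lra.
Qed.

Lemma spectrum_le T t : spectrum T (RtoC t) -> t <= bop_norm T.
Proof.
  intros ht. eapply Rle_trans; [apply Rle_abs|].
  exact (fcalc_bounded T (fun t => t) T t (fcalc_id T) ht).
Qed.

Lemma coercive_shift T m l : coercive m T -> 0 <= l -> coercive m (T + l *: bop_id)%bop.
Proof.
  intros hm hl x. specialize (hm x). bop_push_all. rewrite rip_self.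
  pose proof (pow2_ge_0 (norm x)). nra.
Qed.

Lemma bop_inv_coercive A m : 0 < m -> rsym A -> coercive m A -> is_bop_inv A (bop_inv A).
Proof. intros. apply bop_inv_spec. now apply (coercive_invertible A m). Qed.

Lemma is_bop_inv_l A B x : is_bop_inv A B -> B (A x) = x.
Proof. intros [h _]. rewrite <- bop_compE, h. reflexivity. Qed.

Lemma is_bop_inv_r A B x : is_bop_inv A B -> A (B x) = x.
Proof. intros [_ h]. rewrite <- bop_compE, h. reflexivity. Qed.

(** The inverse of [A = T + l] is [1 / K] times the sum of the geometric
series in [B = 1 - A / K], whose partial sums are polynomials in [T]. The isometry bounds
[1 - (t + l) / K] on the spectrum by the norm of [B], so that the two errors decay at
the same rate. *)
Lemma fcalc_inverse T m l : 0 < m -> rsym T -> coercive m T -> 0 <= l ->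
  fcalc T (fun t => / (t + l)) (bop_inv (T + l *: bop_id)%bop).
Proof.
  intros hm hT hc hl.
  set (A := (T + l *: bop_id)%bop).
  assert (hAs : rsym A). { apply rsym_plus; [exact hT|apply rsym_scal, rsym_id]. }
  assert (hAc : coercive m A) by now apply coercive_shift.
  pose proof (bop_inv_coercive A m hm hAs hAc) as hI.
  pose proof (coercive_inverse_norm A _ m hm hAc hI) as hIn.
  pose proof (bop_norm_ge_0 A) as hA0.
  set (K := bop_norm A + m). assert (hK : 0 < K) by (unfold K; lra).
  set (k := 1 - m / K).
  assert (hk : 0 <= k < 1).
  { unfold k. split.
    - assert (m / K <= 1) by (apply Rle_div_l; unfold K in *; lra). lra.
    - assert (0 < m / K) by now apply Rdiv_lt_0_compat. lra. }
  set (B := (bop_id - / K *: A)%bop).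
  assert (hi : 0 < / K) by now apply Rinv_0_lt_compat.
  assert (fB : fcalc T (fun t => 1 - / K * (t + l)) B).
  { replace B with (1 *: bop_id + (- / K) *: (T + l *: bop_id))%bop
      by (unfold B, A; bop_ring).
    apply fcalc_ext with (fun t => 1 + - / K * (t + l)); [intros; ring|].
    apply (fcalc_plus T (fun _ => 1)); [apply fcalc_const|].
    apply (fcalc_scal T _ (fun t => t + l)).
    apply (fcalc_plus T (fun t => t) (fun _ => l)); [apply fcalc_id|apply fcalc_const]. }
  assert (hB : bop_norm B <= k).
  { assert (hBb : forall x, 0 <= rip (B x) x <= k * norm x ^ 2).
    { intros x. unfold B. bop_push_all. rewrite rip_self.
      pose proof (rip_bop_norm A x) as h1. specialize (hAc x).
      assert (0 <= norm x ^ 2) by apply pow2_ge_0.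
      assert (h2 : / K * rip (A x) x <= / K * (K * norm x ^ 2)).
      { apply Rmult_le_compat_l; unfold K in *; nra. }
      rewrite <- Rmult_assoc, Rinv_l in h2 by lra.
      assert (h3 : / K * (m * norm x ^ 2) <= / K * rip (A x) x)
        by (apply Rmult_le_compat_l; lra).
      unfold k, Rdiv. lra. }
    apply Rle_plus_epsilon. intros e he. apply psd_norm; [| lra|].
    - apply rsym_minus; [apply rsym_id|now apply rsym_scal].
    - intros x. destruct (hBb x) as [b1 b2]. split; [exact b1|].
      pose proof (pow2_ge_0 (norm x)). nra. }
  (* [g] and [G] are the partial sums, built by Horner's rule. *)
  assert (hS : forall n, exists g G, fcalc T g G /\
    (forall t, (t + l) * g t = 1 - (1 - / K * (t + l)) ^ n) /\
    (A * G = bop_id - bop_pow B n)%bop).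
  { induction n as [|n [g [G [h1 [h2 h3]]]]].
    - exists (fun _ => 0), (0 *: bop_id)%bop. split; [apply fcalc_const|]. split.
      + intros t. simpl. ring.
      + simpl. bop_ring.
    - exists (fun t => / K + (1 - / K * (t + l)) * g t), (/ K *: bop_id + B * G)%bop.
      split; [|split].
      + apply (fcalc_plus T (fun _ => / K)); [apply fcalc_const|]. now apply fcalc_mult.
      + intros t. rewrite Rmult_plus_distr_l, (Rmult_comm (1 - _)), <- Rmult_assoc, h2.
        simpl. ring.
      + transitivity (/ K *: A + B * (A * G))%bop; [unfold B; bop_ring|].
        rewrite h3. simpl. unfold B at 1 3. bop_ring. }
  set (R1 := bop_inv A) in *.
  apply fcalc_limit. intros e he.
  destruct (pow_lt_1_zero k ltac:(rewrite Rabs_pos_eq; lra) (e * m) ltac:(nra)) as [n hn].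
  specialize (hn n (le_n n)). rewrite Rabs_pos_eq in hn by (apply pow_le; lra).
  destruct (hS n) as [g [G [h1 [h2 h3]]]]. exists g, G. split; [exact h1|]. split.
  - intros t ht. pose proof (spectrum_ge T m t hT hc ht) as hmt.
    assert (ht0 : 0 < t + l) by lra.
    assert (hb : Rabs (1 - / K * (t + l)) <= k).
    { eapply Rle_trans; [|exact hB].
      exact (fcalc_bounded T (fun t => 1 - / K * (t + l)) B t fB ht). }
    replace (g t - / (t + l)) with (- (1 - / K * (t + l)) ^ n / (t + l)).
    2:{ replace (g t) with ((t + l) * g t / (t + l)) by (field; lra). rewrite h2. field. lra. }
    unfold Rdiv. rewrite Rabs_mult, Rabs_Ropp, <- RPow_abs, Rabs_inv, (Rabs_pos_eq (t + l)) by lra.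
    apply Rle_div_l; [lra|]. apply Rle_trans with (k ^ n).
    + apply pow_incr. split; [apply Rabs_pos|exact hb].
    + nra.
  - replace (G - R1)%bop with (- 1 *: (R1 * bop_pow B n))%bop.
    2:{ replace (bop_pow B n) with (bop_id - A * G)%bop by (rewrite h3; bop_ring).
        apply bop_eq_rip. intros x y. bop_push_all. rewrite (is_bop_inv_l _ _ _ hI). ring. }
    eapply Rle_trans; [apply (bop_norm_scal (-1))|].
    change (abs (-1)) with (Rabs (-1)).
    replace (Rabs (-1)) with 1 by (rewrite Rabs_left; lra). rewrite Rmult_1_l.
    eapply Rle_trans; [apply bop_norm_comp|].
    apply Rle_trans with (/ m * (e * m)); [|right; field; lra].
    apply Rmult_le_compat; try apply bop_norm_ge_0; [exact hIn|].
    eapply Rle_trans; [apply bop_norm_pow|]. left. apply Rle_lt_trans with (2 := hn).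
    apply pow_incr. split; [apply bop_norm_ge_0|exact hB].
Qed.
End Calculus.

(** * Integrals of operators and resolvents *)

Section Integral.
Context {H : hilbertSpace}.
Implicit Types (x y z : H) (S T A B : boundedOp H).

Lemma Riemann_sum_nil {V : ModuleSpace R_Ring} (f : R -> V) c0 :
  Riemann_sum f (SF_nil c0) = zero.
Proof. reflexivity. Qed.

Lemma fcalc_Riemann_sum T (k : R -> R -> R) (K : R -> boundedOp H) ptd :
  (forall l, fcalc T (k l) (K l)) ->
  fcalc T (fun t => Riemann_sum (fun l => k l t) ptd) (Riemann_sum K ptd).
Proof.
  intros h. induction ptd as [c0|h0 s IH] using SF_cons_ind.
  - rewrite Riemann_sum_nil.
    exact (fcalc_poly T nil).
  - rewrite Riemann_sum_cons.
    apply (fcalc_ext T (fun t => (SF_h s - fst h0) * k (snd h0) t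
      + Riemann_sum (fun l => k l t) s)).
    + intros t _. now rewrite Riemann_sum_cons.
    + apply fcalc_plus; [|exact IH]. now apply fcalc_scal.
Qed.

(** Riemann sums of the operators are Riemann sums of the functions, at each point of
the spectrum. The functions converge only pointwise a priori, but the isometry
transfers the Cauchy estimate for the operators to them, uniformly in [t]. *)
Lemma fcalc_RInt_total T (k : R -> R -> R) (K : R -> boundedOp H) a b V :
  (forall l, fcalc T (k l) (K l)) -> is_RInt K a b V ->
  (forall t, spectrum T (RtoC t) -> ex_RInt (fun l => k l t) a b) ->
  fcalc T (fun t => RInt (fun l => k l t) a b) V.
Proof.
  intros hk hV hex. apply fcalc_limit. intros e he.
  set (sg := sign (b - a)).
  assert (hF : forall ptd, fcalc T (fun t => sg * Riemann_sum (fun l => k l t) ptd)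
     (sg *: Riemann_sum K ptd)%bop).
  { intros ptd. apply (fcalc_scal T sg (fun t => Riemann_sum (fun l => k l t) ptd)).
    now apply fcalc_Riemann_sum. }
  pose proof (proj1 (bop_filterlim (Riemann_fine a b) _ _) hV (mkposreal (e / 2) ltac:(lra))) as h1.
  simpl in h1.
  destruct (filter_ex _ h1) as [p0 hp0].
  exists (fun t => sg * Riemann_sum (fun l => k l t) p0), (sg *: Riemann_sum K p0)%bop.
  split; [apply hF|]. split.
  - intros t ht. apply Rle_plus_epsilon. intros d hd.
    pose proof (RInt_correct (V := R_CompleteNormedModule) _ _ _ (hex t ht)) as h2.
    pose proof (proj1 (filterlim_locally (F := Riemann_fine a b) _ _) h2 (mkposreal d hd)) as h3.
    destruct (filter_ex _ (filter_and _ _ h1 h3)) as [p1 [h4 h5]].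
    change (Rabs (sg * Riemann_sum (fun l => k l t) p1 - RInt (fun l => k l t) a b) < d) in h5.
    pose proof (fcalc_eval T _ _ _ _ t (hF p0) (hF p1) ht) as h6. simpl in h6.
    assert (h7 : bop_norm (sg *: Riemann_sum K p0 - sg *: Riemann_sum K p1)%bop <= e).
    { eapply Rle_trans; [apply (bop_norm_minus_trans V)|].
      rewrite (bop_norm_minus_comm V).
      change (scal sg (Riemann_sum K p0)) with (scal (sign (b - a)) (Riemann_sum K p0)).
      apply Rle_trans with (e / 2 + e / 2); [|lra].
      apply Rplus_le_compat; left; [exact hp0|exact h4]. }
    apply Rabs_def2 in h5. apply (Rle_trans _ _ _ h6) in h7.
    apply Rabs_le_between in h7. apply Rabs_le. lra.
  - left. eapply Rlt_trans; [exact hp0|lra].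
Qed.

(** Tags of a subdivision lie in the interval of integration; composing with the
retraction onto it reduces the claim to functions defined for every real [l]. *)
Lemma fcalc_RInt T (k : R -> R -> R) (K : R -> boundedOp H) a b V :
  (forall l, Rmin a b <= l <= Rmax a b -> fcalc T (k l) (K l)) -> is_RInt K a b V ->
  (forall t, spectrum T (RtoC t) -> ex_RInt (fun l => k l t) a b) ->
  fcalc T (fun t => RInt (fun l => k l t) a b) V.
Proof.
  intros hk hV hex.
  set (c := fun l => Rmin (Rmax l (Rmin a b)) (Rmax a b)).
  assert (hmM : Rmin a b <= Rmax a b) by (eapply Rle_trans; [apply Rmin_l|apply Rmax_l]).
  assert (hc : forall l, Rmin a b <= c l <= Rmax a b).
  { intros l. unfold c. split; [|apply Rmin_r]. apply Rmin_glb; [apply Rmax_r|exact hmM]. }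
  assert (hc' : forall l, Rmin a b < l < Rmax a b -> c l = l).
  { intros l hl. unfold c. rewrite (Rmax_left l), Rmin_left; lra. }
  apply (fcalc_ext T (fun t => RInt (fun l => k (c l) t) a b)).
  - intros t _. apply RInt_ext. intros l hl. now rewrite hc'.
  - apply (fcalc_RInt_total T (fun l => k (c l)) (fun l => K (c l))).
    + intros l. apply hk, hc.
    + apply (is_RInt_ext K); [|exact hV]. intros l hl. now rewrite hc'.
    + intros t ht. apply (ex_RInt_ext (fun l => k l t)); [|now apply hex].
      intros l hl. now rewrite hc'.
Qed.

Definition at_0_infty : (R * R -> Prop) -> Prop :=
  filter_prod (at_right 0) (Rbar_locally p_infty).

Lemma at_0_infty_near d : 0 < d ->
  at_0_infty (fun ab => 0 < fst ab <= d /\ / d <= snd ab).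
Proof.
  intros hd. apply (Filter_prod _ _ _ (fun a => 0 < a <= d) (fun b => / d < b)).
  - exists (mkposreal d hd). intros u hu hu0. split; [exact hu0|].
    change (Rabs (u - 0) < d) in hu. apply Rabs_def2 in hu. lra.
  - exists (/ d). intros u hu; exact hu.
  - intros a b ha hb. simpl. lra.
Qed.

Lemma is_RInt_gen_cauchy (f : R -> boundedOp H) :
  (forall a b, 0 < a -> 0 < b -> ex_RInt f a b) ->
  (forall e, 0 < e -> exists d, 0 < d <= 1 /\ forall a b a' b',
     0 < a <= d -> / d <= b -> 0 < a' <= d -> / d <= b' ->
     bop_norm (RInt f a b - RInt f a' b')%bop <= e) ->
  exists V, is_RInt_gen f (at_right 0) (Rbar_locally p_infty) V /\
    filterlim (fun ab => RInt f (fst ab) (snd ab)) at_0_infty (locally V).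
Proof.
  intros hex hc.
  assert (PF : ProperFilter at_0_infty) by (unfold at_0_infty; typeclasses eauto).
  destruct (proj1 (Hierarchy.filterlim_locally_cauchy (F := at_0_infty) (U := bop_CompleteNormedModule)
     (fun ab => RInt f (fst ab) (snd ab)))) as [V hV].
  { intros [e he]. destruct (hc (e / 2) ltac:(lra)) as [d [hd h]].
    exists (fun ab => 0 < fst ab <= d /\ / d <= snd ab).
    split; [now apply at_0_infty_near|].
    intros [a b] [a' b'] [h1 h2] [h3 h4]. simpl in *.
    change (bop_norm (RInt f a' b' - RInt f a b)%bop < e).
    eapply Rle_lt_trans; [apply h; assumption|lra]. }
  exists V. split; [|exact hV].
  intros P hP. unfold filtermapi.
  pose proof (filter_and (F := at_0_infty) (fun ab => P (RInt f (fst ab) (snd ab))) _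
    (hV P hP) (at_0_infty_near 1 Rlt_0_1)) as h.
  apply filter_imp with (2 := h). intros [a b] [h1 [h2 h3]]. simpl in *.
  exists (RInt f a b). split; [|exact h1].
  apply (RInt_correct (V := bop_CompleteNormedModule)). apply hex; lra.
Qed.

Lemma Riemann_sum_sandwich (f : R -> boundedOp H) A B ptd :
  Riemann_sum (fun l => A * f l * B)%bop ptd = (A * Riemann_sum f ptd * B)%bop.
Proof.
  induction ptd as [c0|h0 s IH] using SF_cons_ind.
  - rewrite !Riemann_sum_nil. bop_ring.
  - rewrite !Riemann_sum_cons, IH. bop_ring.
Qed.

Lemma is_RInt_sandwich (f : R -> boundedOp H) A B a b V : is_RInt f a b V ->
  is_RInt (fun l => A * f l * B)%bop a b (A * V * B)%bop.
Proof.
  intros h. unfold is_RInt in *.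
  pose proof (bop_filterlim_sandwich (Riemann_fine a b) _ A B _ h) as h1.
  eapply filterlim_ext; [|exact h1].
  intros ptd. simpl. rewrite Riemann_sum_sandwich. apply bop_eq_rip; intros x y; bop_push_all. reflexivity.
Qed.

Lemma is_RInt_gen_sandwich (f : R -> boundedOp H) A B Fa Fb V :
  Filter Fa -> Filter Fb -> is_RInt_gen f Fa Fb V ->
  is_RInt_gen (fun l => A * f l * B)%bop Fa Fb (A * V * B)%bop.
Proof.
  intros FFa FFb h P hP.
  assert (hP' : locally V (fun W => P (A * W * B)%bop)).
  { apply (bop_filterlim_sandwich (locally V) (fun W => W) A B V (filterlim_id _ _)). exact hP. }
  specialize (h _ hP'). unfold filtermapi in *.
  apply filter_imp with (2 := h). intros [a b] [y [h1 h2]].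
  exists (A * y * B)%bop. split; [now apply is_RInt_sandwich|exact h2].
Qed.

Lemma resolvent_identity A B A' B' : is_bop_inv A A' -> is_bop_inv B B' ->
  (A' - B' = A' * (B - A) * B')%bop.
Proof.
  intros hA hB. apply bop_eq_rip. intros x y. bop_push_all.
  rewrite (is_bop_inv_l _ _ _ hA), (is_bop_inv_r _ _ _ hB). ring.
Qed.

(** Since [l R1 B = 1 - R1 A]. *)
Lemma resolvent_product A B R1 l : l <> 0 -> is_bop_inv (A + l *: B)%bop R1 ->
  (A * R1 * B = / l *: (A - A * R1 * A))%bop.
Proof.
  intros hl [h _].
  transitivity (/ l *: (A * (R1 * (A + l *: B)) - A * R1 * A))%bop.
  - apply bop_eq_rip. intros x y. bop_push_all. now field.
  - rewrite h. bop_ring.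
Qed.

Lemma coercive_perturb A B m s : coercive m A -> Rabs s * bop_norm B <= m / 2 ->
  coercive (m / 2) (A + s *: B)%bop.
Proof.
  intros hA hs x. specialize (hA x). bop_push_all.
  pose proof (rip_bop_norm B x) as h1. pose proof (rip_bop_norm_lower B x) as h2.
  pose proof (pow2_ge_0 (norm x)) as hx.
  assert (h3 : Rabs (s * rip (B x) x) <= Rabs s * (bop_norm B * norm x ^ 2)).
  { rewrite Rabs_mult. apply Rmult_le_compat_l; [apply Rabs_pos|]. apply Rabs_le. lra. }
  assert (h4 : Rabs s * (bop_norm B * norm x ^ 2) <= m / 2 * norm x ^ 2).
  { rewrite <- Rmult_assoc. now apply Rmult_le_compat_r. }
  apply Rabs_le_between in h3. lra.
Qed.

(** The resolvent identity used twice gives the remainder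
[h^2 R(s) B R(s0) B R(s0)] with [h = s - s0], and coercivity
survives small perturbations, with half the constant, which bounds [R(s)]. *)
Lemma is_derive_resolvent A B s0 m : rsym A -> rsym B -> 0 < m ->
  coercive m (A + s0 *: B)%bop ->
  is_derive (fun s => bop_inv (A + s *: B)%bop) s0
    (opp (bop_inv (A + s0 *: B) * B * bop_inv (A + s0 *: B)) : boundedOp H)%bop.
Proof.
  intros hA hB hm hc.
  set (R0 := bop_inv (A + s0 *: B)%bop).
  assert (hs : forall s, rsym (A + s *: B)%bop).
  { intros s. apply rsym_plus; [exact hA|now apply rsym_scal]. }
  pose proof (bop_inv_coercive _ m hm (hs s0) hc) as hI. fold R0 in hI.
  pose proof (coercive_inverse_norm _ _ m hm hc hI) as hn.
  set (n := bop_norm B + 1). pose proof (bop_norm_ge_0 B) as hB0.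
  assert (hn0 : 0 < n) by (unfold n; lra).
  split; [exact (is_linear_scal_l (V := bop_NormedModule) _)|].
  intros s hs0. apply (is_filter_lim_locally_unique (V := R_NormedModule)) in hs0. subst s.
  intros [e he].
  set (c := 2 / m * n * / m * n * / m).
  assert (hi : 0 < / m) by now apply Rinv_0_lt_compat.
  assert (h2m : 0 < 2 / m) by (apply Rdiv_lt_0_compat; lra).
  assert (hcp : 0 < c) by (unfold c; repeat apply Rmult_lt_0_compat; lra).
  assert (hd : 0 < Rmin (m / 2 / n) (e / c)).
  { apply Rmin_glb_lt; apply Rdiv_lt_0_compat; lra. }
  exists (mkposreal _ hd). intros s hs1.
  change (Rabs (s - s0) < Rmin (m / 2 / n) (e / c)) in hs1.
  change (bop_norm ((bop_inv (A + s *: B) - R0) - (s - s0) *: opp (R0 * B * R0))%bop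
    <= e * Rabs (s - s0)).
  set (h := s - s0) in *.
  pose proof (Rmin_l (m / 2 / n) (e / c)) as hm1. pose proof (Rmin_r (m / 2 / n) (e / c)) as hm2.
  pose proof (Rabs_pos h) as hh.
  assert (hcs : coercive (m / 2) (A + s *: B)%bop).
  { replace (A + s *: B)%bop with ((A + s0 *: B) + h *: B)%bop
      by (unfold h; bop_ring).
    apply coercive_perturb; [exact hc|].
    assert (hl : Rabs h < m / 2 / n) by lra.
    apply Rlt_div_r in hl; [|exact hn0]. unfold n in hl. nra. }
  pose proof (bop_inv_coercive _ (m / 2) ltac:(lra) (hs s) hcs) as hIs.
  pose proof (coercive_inverse_norm _ _ (m / 2) ltac:(lra) hcs hIs) as hns.
  replace (/ (m / 2)) with (2 / m) in hns by (field; lra).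
  set (R1 := bop_inv (A + s *: B)%bop) in *.
  pose proof (resolvent_identity _ _ _ _ hIs hI) as hid.
  replace (A + s0 *: B - (A + s *: B))%bop with (- h *: B)%bop in hid
    by (unfold h; bop_ring).
  replace ((R1 - R0) - h *: opp (R0 * B * R0))%bop with ((h * h)%R *: (R1 * B * R0 * B * R0))%bop.
  2:{ transitivity ((- h) *: ((R1 - R0) * B * R0))%bop.
      - rewrite hid. bop_ring.
      - transitivity (R1 * (- h *: B) * R0 - (- h) *: (R0 * B * R0))%bop; [bop_ring|].
        rewrite <- hid. bop_ring. }
  eapply Rle_trans; [apply (bop_norm_scal (h * h))|].
  change (abs (h * h)) with (Rabs (h * h)). rewrite Rabs_mult, Rmult_assoc, Rmult_comm.
  apply Rmult_le_compat_r; [exact hh|].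
  assert (hb : bop_norm (R1 * B * R0 * B * R0)%bop <= c).
  { unfold c.
    assert (hBn : bop_norm B <= n) by (unfold n; lra).
    repeat (eapply Rle_trans; [apply bop_norm_comp|];
      apply Rmult_le_compat; try apply bop_norm_ge_0; try assumption). }
  pose proof (bop_norm_ge_0 (R1 * B * R0 * B * R0)%bop).
  apply Rle_trans with (Rabs h * c); [apply Rmult_le_compat_l; lra|].
  apply Rle_div_r; lra.
Qed.

Lemma continuous_resolvent A B s0 m : rsym A -> rsym B -> 0 < m ->
  coercive m (A + s0 *: B)%bop ->
  continuous (fun s => bop_inv (A + s *: B)%bop) s0.
Proof.
  intros hA hB hm hc.
  apply (ex_derive_continuous (K := R_AbsRing) (V := bop_NormedModule)).
  eexists. now apply (is_derive_resolvent A B s0 m).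
Qed.

Lemma continuous_sandwich (f : R -> boundedOp H) A B s : continuous f s ->
  continuous (fun l => A * f l * B)%bop s.
Proof. intros h. exact (bop_filterlim_sandwich (locally s) f A B _ h). Qed.

Lemma continuous_Rpower c l : 0 < l -> continuous (fun u => Rpower u c) l.
Proof.
  intros hl. apply (ex_derive_continuous (fun u => Rpower u c)). unfold Rpower.
  now auto_derive.
Qed.
End Integral.

(** * Fractional powers and geometric means *)

Section Geomean.
Context {H : hilbertSpace}.
Implicit Types (x y z : H) (S T A B C D Q X : boundedOp H).

Lemma bop_norm_scal_eq (a : R) T : 0 <= a -> bop_norm (a *: T)%bop = a * bop_norm T.
Proof.
  intros ha. apply Rle_antisym.
  - eapply Rle_trans; [apply (bop_norm_scal a T)|].
    change (abs a) with (Rabs a). rewrite Rabs_pos_eq by exact ha. lra.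
  - destruct ha as [ha|<-].
    + rewrite Rmult_comm. apply Rle_div_r; [exact ha|].
      replace T with (/ a *: (a *: T))%bop at 1.
      * eapply Rle_trans; [apply (bop_norm_scal (/ a) (a *: T)%bop)|].
        change (abs (/ a)) with (Rabs (/ a)). rewrite Rabs_inv, Rabs_pos_eq by lra.
        unfold Rdiv. lra.
      * apply bop_eq_rip. intros x y. bop_push_all. field. lra.
    + rewrite Rmult_0_l. apply bop_norm_ge_0.
Qed.

Lemma power_kernel_continuous T m r l : rsym T -> 0 < m -> coercive m T -> 0 < l ->
  continuous (fun l => Rpower l (r - 1) *: (T * bop_inv (T + l *: bop_id)))%bop l.
Proof.
  intros hT hm hc hl.
  apply (continuous_scal (V := bop_NormedModule) (fun l => Rpower l (r - 1))
    (fun l => T * bop_inv (T + l *: bop_id))%bop); [now apply continuous_Rpower|].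
  apply (continuous_ext (fun l => T * bop_inv (T + l *: bop_id) * bop_id)%bop).
  { intros u. bop_ring. }
  apply continuous_sandwich, (continuous_resolvent _ _ _ m); [exact hT|apply rsym_id|exact hm|].
  apply coercive_shift; [exact hc|lra].
Qed.

(** Truncated integrals are [f(T)] for the truncated scalar integrals [f], and
these converge uniformly on the spectrum by [power_integral]. The isometry makes the
operators converge, and their limit represents [t^r]; in particular the power of [T]
exists as a limit of polynomials. *)
Lemma power_integral_op T r : spd T -> 0 < r < 1 -> exists V : boundedOp H,
  is_RInt_gen (fun l => Rpower l (r - 1) *: (T * bop_inv (T + l *: bop_id)))%bop
    (at_right 0) (Rbar_locally p_infty) V /\
  fcalc T (fun t => Rpower t r) ((sin (r * PI) / PI) *: V)%bop.
Proof.
  intros [hT [m [hm hc]]] hr.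
  set (K := fun l : R => (Rpower l (r - 1) *: (T * bop_inv (T + l *: bop_id)))%bop : boundedOp H).
  set (k := fun l t => Rpower l (r - 1) * (t / (t + l))).
  set (kap := sin (r * PI) / PI).
  pose proof PI_RGT_0 as hpi.
  assert (hkap : 0 < kap).
  { apply Rdiv_lt_0_compat; [apply sin_gt_0; nra|exact hpi]. }
  set (M := Rmax m (bop_norm T)).
  assert (hmM : 0 < m <= M) by (split; [exact hm|apply Rmax_l]).
  assert (hsp : forall t, spectrum T (RtoC t) -> m <= t <= M).
  { intros t ht. split; [now apply (spectrum_ge T)|].
    eapply Rle_trans; [exact (spectrum_le T t ht)|apply Rmax_r]. }
  assert (hex : forall a b, 0 < a -> 0 < b -> ex_RInt (V := bop_NormedModule) K a b).
  { intros a b ha hb. apply (ex_RInt_continuous (V := bop_CompleteNormedModule)).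
    intros l hl. apply (power_kernel_continuous T m); try assumption.
    apply Rlt_le_trans with (2 := proj1 hl). now apply Rmin_glb_lt. }
  assert (hf : forall a b, 0 < a -> 0 < b ->
    fcalc T (fun t => kap * RInt (fun l => k l t) a b) (kap *: RInt K a b)%bop).
  { intros a b ha hb. apply (fcalc_scal T kap (fun t => RInt (fun l => k l t) a b)).
    assert (hab : 0 < Rmin a b) by now apply Rmin_glb_lt.
    apply (fcalc_RInt T k K).
    - intros l hl. unfold k, K. apply fcalc_scal.
      apply (fcalc_mult T (fun t => t)); [apply fcalc_id|].
      apply (fcalc_inverse T m); try assumption; lra.
    - apply (RInt_correct (V := bop_CompleteNormedModule)). now apply hex.
    - intros t ht. pose proof (hsp t ht).
      apply (ex_RInt_continuous (V := R_CompleteNormedModule)). intros l hl.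
      apply (ex_derive_continuous (fun l => k l t)). unfold k, Rpower.
      auto_derive. repeat split; lra. }
  destruct (is_RInt_gen_cauchy K hex) as [V [hV1 hV2]].
  { intros e he.
    destruct (power_integral r m M hr hmM (kap * e / 2)) as [d [hd h]]; [nra|].
    exists d. split; [exact hd|]. intros a b a' b' ha hb ha' hb'.
    assert (hd0 : 0 < / d) by (apply Rinv_0_lt_compat; lra).
    apply (Rmult_le_reg_l kap); [exact hkap|].
    rewrite <- bop_norm_scal_eq by lra.
    apply Rle_trans with (bop_norm (kap *: RInt K a b - kap *: RInt K a' b')%bop).
    { right. f_equal. bop_ring. }
    apply (fcalc_dist T _ _ _ _ _ hT (hf a b ltac:(lra) ltac:(lra))
      (hf a' b' ltac:(lra) ltac:(lra))); [nra|].
    intros t ht. pose proof (hsp t ht) as ht'.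
    pose proof (h a b ha hb t ht') as h1. pose proof (h a' b' ha' hb' t ht') as h2.
    fold kap in h1, h2. unfold k.
    apply Rabs_le_between in h1, h2. apply Rabs_le. lra. }
  exists V. split; [exact hV1|].
  apply fcalc_limit. intros e he.
  destruct (power_integral r m M hr hmM e he) as [d [hd h]].
  assert (hd0 : 0 < / d) by (apply Rinv_0_lt_compat; lra).
  assert (PF : ProperFilter at_0_infty) by (unfold at_0_infty; typeclasses eauto).
  pose proof (proj1 (bop_filterlim at_0_infty _ _) hV2
    (mkposreal (e / kap) (Rdiv_lt_0_compat _ _ he hkap))) as h1.
  destruct (filter_ex _ (filter_and _ _ h1 (at_0_infty_near d (proj1 hd))))
    as [[a b] [h2 [h3 h4]]].
  simpl in h2, h3, h4.
  exists (fun t => kap * RInt (fun l => k l t) a b), (kap *: RInt K a b)%bop.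
  split; [apply hf; lra|]. split.
  - intros t ht. apply (h a b h3 h4 t (hsp t ht)).
  - apply Rle_trans with (bop_norm (kap *: (RInt K a b - V))%bop).
    { right. f_equal. bop_ring. }
    rewrite bop_norm_scal_eq by lra.
    apply Rlt_div_r in h2; [|exact hkap].
    left. eapply Rle_lt_trans; [|exact h2]. right. apply Rmult_comm.
Qed.

Lemma bop_power_fcalc T nu S : rsym T -> fcalc T (fun t => Rpower t nu) S ->
  bop_power T nu = S.
Proof.
  intros hT h. apply (fcalc_unique T (fun t => Rpower t nu)); [exact hT| |exact h].
  apply is_bop_fun_fcalc. unfold bop_power.
  apply (epsilon_spec (inhabits (bop_zero : boundedOp H)) (is_bop_fun (fun t => Rpower t nu) T)).
  exists S. now apply fcalc_is_bop_fun.
Qed.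

Lemma spd_spectrum_pos T t : spd T -> spectrum T (RtoC t) -> 0 < t.
Proof.
  intros [hT [m [hm hc]]] ht. pose proof (spectrum_ge T m t hT hc ht). lra.
Qed.

Lemma bop_power_1 T : spd T -> bop_power T 1 = T.
Proof.
  intros hT. apply bop_power_fcalc; [apply hT|].
  apply (fcalc_ext T (fun t => t)); [|apply fcalc_id].
  intros t ht. symmetry. apply Rpower_1. now apply (spd_spectrum_pos T).
Qed.

(** The square root comes from the integral representation, and the inverse square
root is its product with the inverse of [T]. All identities follow from uniqueness
of [f(T)]. *)
Lemma spd_sqrt T : spd T -> exists P N : boundedOp H,
  bop_power T (1 / 2) = P /\ bop_power T (- (1 / 2)) = N /\
  rsym P /\ rsym N /\ (P * P = T)%bop /\ (P * N = bop_id)%bop /\ (N * P = bop_id)%bop.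
Proof.
  intros hs. pose proof hs as [hT [m [hm hc]]].
  destruct (power_integral_op T (1 / 2) hs ltac:(lra)) as [V [_ hP]].
  set (P := (sin (1 / 2 * PI) / PI *: V)%bop) in *.
  pose proof (fcalc_inverse T m 0 hm hT hc (Rle_refl 0)) as hi.
  pose proof (fcalc_mult T _ _ _ _ hi hP) as hN0. simpl in hN0.
  set (N := (bop_inv (T + 0 *: bop_id) * P)%bop) in *.
  assert (hN : fcalc T (fun t => Rpower t (- (1 / 2))) N).
  { apply fcalc_ext with (2 := hN0). intros t ht.
    pose proof (spd_spectrum_pos T t hs ht) as ht0. rewrite Rplus_0_r.
    replace (- (1 / 2)) with (1 / 2 + Ropp 1) by field.
    rewrite Rpower_plus, Rpower_Ropp, Rpower_1 by exact ht0. ring. }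
  assert (id1 : fcalc T (fun _ => 1) bop_id).
  { replace bop_id with (1 *: bop_id : boundedOp H)%bop by bop_ring. apply fcalc_const. }
  exists P, N. repeat split.
  - now apply bop_power_fcalc.
  - now apply bop_power_fcalc.
  - exact (rsym_fcalc T _ P hT hP).
  - exact (rsym_fcalc T _ N hT hN).
  - apply (fcalc_unique T (fun t => t)); [exact hT| |apply fcalc_id].
    apply fcalc_ext with (2 := fcalc_mult T _ _ _ _ hP hP). intros t ht. simpl.
    rewrite <- Rpower_plus. replace (1 / 2 + 1 / 2) with 1 by field.
    apply Rpower_1. now apply (spd_spectrum_pos T).
  - apply (fcalc_unique T (fun _ => 1)); [exact hT| |exact id1].
    apply fcalc_ext with (2 := fcalc_mult T _ _ _ _ hP hN). intros t ht. simpl.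
    rewrite <- Rpower_plus, Rplus_opp_r. apply Rpower_O. now apply (spd_spectrum_pos T).
  - apply (fcalc_unique T (fun _ => 1)); [exact hT| |exact id1].
    apply fcalc_ext with (2 := fcalc_mult T _ _ _ _ hN hP). intros t ht. simpl.
    rewrite <- Rpower_plus, Rplus_opp_l. apply Rpower_O. now apply (spd_spectrum_pos T).
Qed.

Lemma coercive_weaken A m m' : coercive m A -> m' <= m -> coercive m' A.
Proof. intros h hm x. specialize (h x). pose proof (pow2_ge_0 (norm x)). nra. Qed.

Lemma coercive_plus_scal A B a b l : coercive a A -> coercive b B -> 0 <= l ->
  coercive (a + l * b) (A + l *: B)%bop.
Proof.
  intros hA hB hl x. specialize (hA x). specialize (hB x). bop_push_all.
  apply (Rmult_le_compat_l l) in hB; [lra|exact hl].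
Qed.

Lemma spd_plus_scal A B l : spd A -> spd B -> 0 <= l -> spd (A + l *: B)%bop.
Proof.
  intros [sA [a [ha cA]]] [sB [b [hb cB]]] hl. split.
  - apply rsym_plus; [exact sA|now apply rsym_scal].
  - exists (a + l * b). split; [nra|now apply coercive_plus_scal].
Qed.

Lemma bop_inv_plus_scal A B l : spd A -> spd B -> 0 < l ->
  is_bop_inv (A + l *: B)%bop (bop_inv (A + l *: B)%bop).
Proof.
  intros hA hB hl. apply bop_inv_spec, spd_invertible, spd_plus_scal; [exact hA|exact hB|lra].
Qed.

Lemma spd_congruence N Q : rsym N -> bop_invertible N -> spd Q -> spd (N * Q * N)%bop.
Proof.
  intros hN hi [hQ [q [hq cQ]]]. split; [now apply rsym_sandwich|].
  destruct (invertible_lower_bound N hi) as [c [hc h]].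
  exists (q * c ^ 2). split; [apply Rmult_lt_0_compat; [exact hq|now apply pow_lt]|].
  intros x. rewrite !bop_compE, hN. specialize (cQ (N x)). specialize (h x).
  pose proof (hnorm_ge_0 x).
  assert ((c * norm x) ^ 2 <= norm (N x) ^ 2) by (apply pow_incr; nra).
  replace (q * c ^ 2 * norm x ^ 2) with (q * (c * norm x) ^ 2) by ring. nra.
Qed.

Lemma bop_inv_congruence P N A R1 : (P * N = bop_id)%bop -> (N * P = bop_id)%bop ->
  is_bop_inv A R1 -> is_bop_inv (N * A * N)%bop (P * R1 * P)%bop.
Proof.
  intros h1 h2 [h3 h4]. split.
  - transitivity (P * R1 * (P * N) * A * N)%bop; [bop_ring|]. rewrite h1.
    transitivity (P * (R1 * A) * N)%bop; [bop_ring|]. rewrite h3.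
    transitivity (P * N)%bop; [bop_ring|exact h1].
  - transitivity (N * A * (N * P) * R1 * P)%bop; [bop_ring|]. rewrite h2.
    transitivity (N * (A * R1) * P)%bop; [bop_ring|]. rewrite h4.
    transitivity (N * P)%bop; [bop_ring|exact h2].
Qed.

(** With [Y = N Q N], where [P] and [N] are the square root of [X] and its inverse,
[Y + l = N (Q + l X) N]; hence [P Y (Y + l)^-1 P = Q (Q + l X)^-1 X]. *)
Lemma geomean_integral Q X r : spd Q -> spd X -> 0 < r < 1 -> exists V : boundedOp H,
  is_RInt_gen (fun l => Rpower l (r - 1) *: (Q * bop_inv (Q + l *: X) * X))%bop
    (at_right 0) (Rbar_locally p_infty) V /\
  geomean r X Q = ((sin (r * PI) / PI) *: V)%bop.
Proof.
  intros hQ hX hr. destruct (spd_sqrt X hX) as [P [N [eP [eN [sP [sN [PP [PN NP]]]]]]]].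
  assert (hNi : bop_invertible N) by (exists P; split; assumption).
  pose proof (spd_congruence N Q sN hNi hQ) as hY.
  destruct (power_integral_op (N * Q * N)%bop r hY hr) as [V [hV1 hV2]].
  exists (P * V * P)%bop. split.
  - assert (hS := is_RInt_gen_sandwich _ P P (at_right 0) (Rbar_locally p_infty) V
      _ _ hV1).
    eapply (is_RInt_gen_ext (V := bop_NormedModule)); [|exact hS].
    apply filter_imp with (2 := at_0_infty_near 1 Rlt_0_1).
    intros [a b] [ha hb] l hl. simpl in *. rewrite Rinv_1 in hb.
    assert (hl0 : 0 < l).
    { apply Rlt_trans with (2 := proj1 hl). apply Rmin_glb_lt; lra. }
    pose proof (bop_inv_plus_scal Q X l hQ hX hl0) as hI.
    set (R1 := bop_inv (Q + l *: X)%bop) in *.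
    assert (E : bop_inv (N * Q * N + l *: bop_id)%bop = (P * R1 * P)%bop).
    { apply bop_inv_eq.
      replace (N * Q * N + l *: bop_id)%bop with (N * (Q + l *: X) * N)%bop.
      - now apply bop_inv_congruence.
      - rewrite <- PP. transitivity (N * Q * N + l *: ((N * P) * (P * N)))%bop; [bop_ring|].
        rewrite NP, PN. bop_ring. }
    rewrite E.
    transitivity (Rpower l (r - 1) *: ((P * N) * Q * (N * P) * R1 * (P * P)))%bop; [bop_ring|].
    rewrite PN, NP, PP. bop_ring.
  - unfold geomean. rewrite eP, eN, (bop_power_fcalc _ _ _ (proj1 hY) hV2). bop_ring.
Qed.

Lemma geomean_1 Q X : spd Q -> spd X -> geomean 1 X Q = Q.
Proof.
  intros hQ hX. destruct (spd_sqrt X hX) as [P [N [eP [eN [sP [sN [PP [PN NP]]]]]]]].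
  assert (hNi : bop_invertible N) by (exists P; split; assumption).
  unfold geomean. rewrite eP, eN, (bop_power_1 _ (spd_congruence N Q sN hNi hQ)).
  transitivity ((P * N) * Q * (N * P))%bop; [bop_ring|]. rewrite PN, NP. bop_ring.
Qed.

Lemma filterlim_bop_comp {I : Type} (F : (I -> Prop) -> Prop) {FF : Filter F}
  (f g : I -> boundedOp H) A B :
  filterlim f F (locally A) -> filterlim g F (locally B) ->
  filterlim (fun i => f i * g i)%bop F (locally (A * B)%bop).
Proof.
  intros hf hg. apply (bop_filterlim F). intros [e he].
  pose proof (bop_norm_ge_0 A) as hA. pose proof (bop_norm_ge_0 B) as hB.
  set (d := Rmin 1 (e / (bop_norm A + bop_norm B + 1))).
  assert (hd0 : 0 < d) by (apply Rmin_glb_lt; [lra|apply Rdiv_lt_0_compat; lra]).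
  assert (hd1 : d <= 1) by apply Rmin_l.
  assert (hd2 : (bop_norm A + bop_norm B + 1) * d <= e).
  { rewrite Rmult_comm. apply Rle_div_r; [lra|apply Rmin_r]. }
  pose proof (proj1 (bop_filterlim F f A) hf (mkposreal d hd0)) as h1.
  pose proof (proj1 (bop_filterlim F g B) hg (mkposreal d hd0)) as h2.
  apply filter_imp with (2 := filter_and _ _ h1 h2). simpl. intros i [h3 h4].
  replace (f i * g i - A * B)%bop with
    ((f i - A) * (g i - B) + ((f i - A) * B + A * (g i - B)))%bop by bop_ring.
  pose proof (bop_norm_ge_0 (f i - A)%bop). pose proof (bop_norm_ge_0 (g i - B)%bop).
  eapply Rle_lt_trans; [apply bop_norm_triangle|].
  apply Rle_lt_trans with (bop_norm (f i - A)%bop * bop_norm (g i - B)%bop +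
    (bop_norm (f i - A)%bop * bop_norm B + bop_norm A * bop_norm (g i - B)%bop)).
  - apply Rplus_le_compat; [apply bop_norm_comp|].
    eapply Rle_trans; [apply bop_norm_triangle|].
    apply Rplus_le_compat; apply bop_norm_comp.
  - nra.
Qed.

(** * The segment from C to D *)

Section Segment.
Context (C D Q : boundedOp H) (hC : spd C) (hD : spd D) (hQ : spd Q).

Let resolvent (l t : R) : boundedOp H := bop_inv (Q + l *: ((1 - t) *: C + t *: D))%bop.

(** The integrand is the derivative in [t] of [- (1 / l) Q R(t) Q], where [R(t)] is
the resolvent; by [resolvent_product] the increment can be written with one resolvent
in each term. *)
Lemma segment_is_RInt l : 0 < l ->
  is_RInt (fun t => Q * resolvent l t * (D - C) * resolvent l t * Q)%bop 0 1
    (Q * bop_inv (Q + l *: D) * D - Q * bop_inv (Q + l *: C) * C)%bop.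
Proof.
  intros hl.
  pose proof hQ as [sQ [q [hq cQ]]].
  pose proof hC as [sC [c [hc cC]]]. pose proof hD as [sD [d [hd cD]]].
  pose (A := (Q + l *: C)%bop). pose (B := (l *: (D - C))%bop).
  assert (sA : rsym A) by (apply rsym_plus; [exact sQ|now apply rsym_scal]).
  assert (sB : rsym B) by now apply rsym_scal, rsym_minus.
  assert (hpath : forall t, resolvent l t = bop_inv (A + t *: B)%bop).
  { intros t. unfold resolvent, A, B. f_equal. bop_ring. }
  assert (hco : forall t, 0 <= t <= 1 -> coercive q (A + t *: B)%bop).
  { intros t ht x. unfold A, B. specialize (cQ x). specialize (cC x). specialize (cD x).
    pose proof (pow2_ge_0 (norm x)). bop_push_all.
    assert (0 <= rip (C x) x) by nra. assert (0 <= rip (D x) x) by nra.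
    assert (0 <= l * ((1 - t) * rip (C x) x + t * rip (D x) x)).
    { apply Rmult_le_pos; [lra|]. apply Rplus_le_le_0_compat; apply Rmult_le_pos; lra. }
    nra. }
  assert (h : is_RInt (fun t => opp (bop_inv (A + t *: B) * B * bop_inv (A + t *: B)) : boundedOp H)%bop 0 1
     (bop_inv (A + 1 *: B) - bop_inv (A + 0 *: B))%bop).
  { apply (is_RInt_derive (V := bop_CompleteNormedModule) (fun t => bop_inv (A + t *: B)%bop)).
    - intros t. rewrite Rmin_left, Rmax_right by lra. intros ht.
      apply (is_derive_resolvent A B t q); try assumption. now apply hco.
    - intros t. rewrite Rmin_left, Rmax_right by lra. intros ht.
      assert (hr : continuous (fun t => bop_inv (A + t *: B)%bop) t).
      { apply (continuous_resolvent A B t q); try assumption. now apply hco. }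
      apply (continuous_opp (V := bop_NormedModule)).
      apply (filterlim_bop_comp (locally t)); [|exact hr].
      apply (filterlim_bop_comp (locally t)); [exact hr|].
      apply filterlim_const. }
  apply (is_RInt_sandwich _ (- / l *: Q)%bop Q) in h.
  pose proof (bop_inv_plus_scal Q C l hQ hC hl) as hI0.
  pose proof (bop_inv_plus_scal Q D l hQ hD hl) as hI1.
  replace (A + 0 *: B)%bop with (Q + l *: C)%bop in h by (unfold A, B; bop_ring).
  replace (A + 1 *: B)%bop with (Q + l *: D)%bop in h by (unfold A, B; bop_ring).
  set (R0 := bop_inv (Q + l *: C)%bop) in *. set (R1 := bop_inv (Q + l *: D)%bop) in *.
  rewrite (resolvent_product Q D R1 l) by (lra || exact hI1).
  rewrite (resolvent_product Q C R0 l) by (lra || exact hI0).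
  evar_last.
  2: match type of h with is_RInt _ _ _ ?V => transitivity V; [reflexivity|bop_ring] end.
  apply is_RInt_ext with (2 := h). intros t _. rewrite hpath.
  generalize (bop_inv (A + t *: B)%bop). intros R2. unfold B.
  apply bop_eq_rip. intros x y. bop_push_all. field. lra.
Qed.

(** This factored form of the increment is [O (1)] at 0 and [O (l^-2)] at infinity,
while its two terms are only [O (1 / l)] at infinity. *)
Lemma segment_product l : 0 < l ->
  (Q * bop_inv (Q + l *: D) * D - Q * bop_inv (Q + l *: C) * C =
   Q * bop_inv (Q + l *: C) * (D - C) * bop_inv (Q + l *: D) * Q)%bop.
Proof.
  intros hl.
  pose proof (bop_inv_plus_scal Q C l hQ hC hl) as hI0.
  pose proof (bop_inv_plus_scal Q D l hQ hD hl) as hI1.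
  pose proof (resolvent_identity _ _ _ _ hI0 hI1) as hr.
  set (R0 := bop_inv (Q + l *: C)%bop) in *. set (R1 := bop_inv (Q + l *: D)%bop) in *.
  rewrite (resolvent_product Q D R1 l) by (lra || exact hI1).
  rewrite (resolvent_product Q C R0 l) by (lra || exact hI0).
  transitivity (/ l *: (Q * (R0 - R1) * Q))%bop; [bop_ring|]. rewrite hr.
  apply bop_eq_rip. intros x y. bop_push_all. field. lra.
Qed.

Let G (l : R) : boundedOp H :=
  (Q * bop_inv (Q + l *: C) * (D - C) * bop_inv (Q + l *: D) * Q)%bop.

Lemma segment_product_continuous l : 0 < l -> continuous G l.
Proof.
  intros hl.
  assert (hr : forall X, spd X -> continuous (fun l => bop_inv (Q + l *: X)%bop) l).
  { intros X hX. destruct (spd_plus_scal Q X l hQ hX (Rlt_le _ _ hl)) as [_ [m [hm hm']]].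
    apply (continuous_resolvent Q X l m); [apply hQ|apply hX|exact hm|exact hm']. }
  unfold G.
  repeat first [apply filterlim_const | exact (hr C hC) | exact (hr D hD)
    | apply (filterlim_bop_comp (locally l))].
Qed.

Lemma segment_product_bound : exists K, 0 <= K /\ forall l, 0 < l ->
  bop_norm (G l) <= K /\ bop_norm (G l) <= K / l ^ 2.
Proof.
  pose proof hQ as [sQ [q [hq cQ]]].
  pose proof hC as [sC [c [hc cC]]]. pose proof hD as [sD [d [hd cD]]].
  set (m := Rmin q (Rmin c d)).
  assert (hm : 0 < m) by (repeat apply Rmin_glb_lt; assumption).
  assert (mq : m <= q) by apply Rmin_l.
  assert (mc : m <= c) by (eapply Rle_trans; [apply Rmin_r|apply Rmin_l]).
  assert (md : m <= d) by (eapply Rle_trans; [apply Rmin_r|apply Rmin_r]).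
  pose proof (bop_norm_ge_0 Q) as nQ. pose proof (bop_norm_ge_0 (D - C)%bop) as nE.
  exists (bop_norm Q * / m * bop_norm (D - C)%bop * / m * bop_norm Q).
  assert (him : 0 < / m) by now apply Rinv_0_lt_compat.
  split. { repeat apply Rmult_le_pos; lra. }
  intros l hl.
  (* Both bounds at once: [Q + l X] is bounded below by [m] and by [l m]. *)
  assert (key : forall s, 0 < s -> (s = 1 \/ s = l) ->
    bop_norm (G l) <= bop_norm Q * / m * bop_norm (D - C)%bop * / m * bop_norm Q / s ^ 2).
  { intros s hs hsl.
    assert (hb : forall X a, spd X -> coercive a X -> m <= a ->
      bop_norm (bop_inv (Q + l *: X)%bop) <= / (s * m)).
    { intros X a hX ca ha. apply (coercive_inverse_norm (Q + l *: X)%bop); [nra| |].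
      - apply coercive_weaken with (q + l * a).
        { apply coercive_plus_scal; [exact cQ|exact ca|lra]. }
        destruct hsl as [-> | ->]; nra.
      - apply bop_inv_spec, spd_invertible, spd_plus_scal; [exact hQ|exact hX|lra]. }
    pose proof (hb C c hC cC mc) as hb1. pose proof (hb D d hD cD md) as hb2.
    replace (_ / s ^ 2) with (bop_norm Q * / (s * m) * bop_norm (D - C)%bop * / (s * m) * bop_norm Q)
      by (field; lra).
    unfold G.
    repeat (eapply Rle_trans; [apply bop_norm_comp|];
      apply Rmult_le_compat; try apply bop_norm_ge_0; try assumption; try apply Rle_refl). }
  split.
  - pose proof (key 1 Rlt_0_1 (or_introl eq_refl)) as h. rewrite pow1, Rdiv_1_r in h. exact h.
  - apply (key l hl). now right.
Qed.

(** For [r = 1] the kernels of the two geometric means are not integrable at infinity,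
so that convergence has to come from the decay of their difference. *)
Lemma segment_product_integrable : exists V,
  is_RInt_gen G (at_right 0) (Rbar_locally p_infty) V.
Proof.
  assert (hex : forall a b, 0 < a -> 0 < b -> ex_RInt (V := bop_NormedModule) G a b).
  { intros a b ha hb. apply (ex_RInt_continuous (V := bop_CompleteNormedModule)).
    intros l hl. apply segment_product_continuous.
    apply Rlt_le_trans with (2 := proj1 hl). now apply Rmin_glb_lt. }
  destruct segment_product_bound as [K [hK hG]].
  assert (h1 : forall a a' d, 0 < a <= d -> 0 < a' <= d -> a <= a' ->
    bop_norm (RInt G a a') <= K * d).
  { intros a a' d ha ha' haa.
    apply Rle_trans with ((a' - a) * K); [|nra].
    apply (norm_RInt_le_const (V := bop_NormedModule) G a a'); [exact haa| |].
    - intros l hl. apply hG. lra.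
    - apply (RInt_correct (V := bop_CompleteNormedModule)), hex; lra. }
  assert (h2 : forall b b' d, 0 < d -> / d <= b -> / d <= b' -> b <= b' ->
    bop_norm (RInt G b b') <= K * d).
  { intros b b' d hd hb hb' hbb.
    assert (hd0 : 0 < / d) by now apply Rinv_0_lt_compat.
    apply Rle_trans with (minus (- K / b') (- K / b)).
    - apply (norm_RInt_le (V := bop_NormedModule) G (fun l => K / l ^ 2) b b'); [exact hbb| | |].
      + intros l hl. apply hG. lra.
      + apply (RInt_correct (V := bop_CompleteNormedModule)), hex; lra.
      + apply (is_RInt_derive (fun l => - K / l)).
        * intros l. rewrite Rmin_left by lra. intros hl. auto_derive; [lra|]. field. lra.
        * intros l. rewrite Rmin_left by lra. intros hl.
          apply (ex_derive_continuous (fun l => K / l ^ 2)). auto_derive. simpl. nra.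
    - unfold minus, plus, opp; simpl.
      assert (0 < / b') by (apply Rinv_0_lt_compat; lra).
      assert (/ b <= d).
      { rewrite <- (Rinv_inv d). apply Rinv_le_contravar; lra. }
      unfold Rdiv. nra. }
  destruct (is_RInt_gen_cauchy G hex) as [V [hV _]]; [|now exists V].
  assert (sw : forall a b, 0 < a -> 0 < b -> bop_norm (RInt G a b) = bop_norm (RInt G b a)).
  { intros a b ha hb. rewrite <- (opp_RInt_swap (V := bop_CompleteNormedModule)) by now apply hex.
    apply bop_norm_opp. }
  intros e he. exists (Rmin 1 (e / (2 * K + 1))).
  set (d := Rmin 1 (e / (2 * K + 1))).
  assert (hd0 : 0 < d) by (apply Rmin_glb_lt; [lra|apply Rdiv_lt_0_compat; lra]).
  assert (hd1 : d <= 1) by apply Rmin_l.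
  assert (hd2 : (2 * K + 1) * d <= e).
  { rewrite Rmult_comm. apply Rle_div_r; [lra|apply Rmin_r]. }
  split; [lra|]. intros a b a' b' ha hb ha' hb'.
  assert (hid : 0 < / d) by now apply Rinv_0_lt_compat.
  assert (E : (RInt G a b - RInt G a' b' = RInt G a a' + RInt G b' b)%bop).
  { rewrite <- (RInt_Chasles (V := bop_CompleteNormedModule) G a a' b) by (apply hex; lra).
    rewrite <- (RInt_Chasles (V := bop_CompleteNormedModule) G a' b' b) by (apply hex; lra).
    bop_ring. }
  rewrite E. eapply Rle_trans; [apply bop_norm_triangle|].
  assert (bop_norm (RInt G a a') <= K * d).
  { destruct (Rle_dec a a'); [apply h1; lra|]. rewrite sw by lra. apply h1; lra. }
  assert (bop_norm (RInt G b' b) <= K * d).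
  { destruct (Rle_dec b' b); [apply h2; lra|]. rewrite sw by lra. apply h2; lra. }
  lra.
Qed.
End Segment.
End Geomean.

Theorem proposition2 (H : hilbertSpace) (C D Q : boundedOp H) (r : R)
  (C_pos : bop_pos C) (D_pos : bop_pos D) (Q_pos : bop_pos Q)
  (r_range : 0 < r <= 1) :
  let resolvent (lambda t : R) : boundedOp H :=
    bop_inv (Q + lambda *: ((1 - t) *: C + t *: D))%bop in
  let integrand (lambda t : R) : boundedOp H :=
    (Q * resolvent lambda t * (D - C) * resolvent lambda t * Q)%bop in
  let outer (lambda : R) : boundedOp H :=
    scal (Rpower lambda (r - 1)) (RInt (integrand lambda) 0 1) in
  (forall lambda : R, 0 < lambda -> ex_RInt (integrand lambda) 0 1) /\
  ex_RInt_gen outer (at_right 0) (Rbar_locally p_infty) /\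
  minus (geomean r D Q) (geomean r C Q) =
    scal (sin (r * PI) / PI) (RInt_gen outer (at_right 0) (Rbar_locally p_infty)).
Proof.
  intros resolvent integrand outer.
  apply bop_pos_spd in C_pos, D_pos, Q_pos.
  assert (inner_int : forall l, 0 < l -> is_RInt (integrand l) 0 1
    (Q * bop_inv (Q + l *: D) * D - Q * bop_inv (Q + l *: C) * C)%bop).
  { intros l hl. now apply segment_is_RInt. }
  assert (outer_gen : forall (g : R -> boundedOp H) V,
    (forall l, 0 < l -> g l = outer l) ->
    is_RInt_gen g (at_right 0) (Rbar_locally p_infty) V ->
    is_RInt_gen outer (at_right 0) (Rbar_locally p_infty) V).
  { intros g V hg hV. apply (is_RInt_gen_ext (V := bop_NormedModule) g); [|exact hV].
    apply filter_imp with (2 := at_0_infty_near 1 Rlt_0_1).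
    intros [a b] [ha hb] l hl. simpl in *. rewrite Rinv_1 in hb. apply hg.
    apply Rlt_trans with (2 := proj1 hl). apply Rmin_glb_lt; lra. }
  assert (outer_eq : forall l, 0 < l -> outer l = (Rpower l (r - 1) *:
    (Q * bop_inv (Q + l *: D) * D - Q * bop_inv (Q + l *: C) * C))%bop).
  { intros l hl. unfold outer. f_equal.
    apply (is_RInt_unique (V := bop_CompleteNormedModule)). now apply inner_int. }
  split; [intros l hl; eexists; now apply inner_int|].
  destruct (Req_dec r 1) as [-> | hr].
  - destruct (segment_product_integrable C D Q C_pos D_pos Q_pos) as [V hV].
    apply outer_gen in hV.
    + split; [now exists V|]. rewrite !geomean_1 by assumption.
      rewrite Rmult_1_l, sin_PI. unfold Rdiv. rewrite Rmult_0_l. bop_ring.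
    + intros l hl. rewrite outer_eq, segment_product by assumption.
      rewrite Rminus_diag, Rpower_O by exact hl. bop_ring.
  - destruct (geomean_integral Q C r Q_pos C_pos ltac:(lra)) as [VC [hC eC]].
    destruct (geomean_integral Q D r Q_pos D_pos ltac:(lra)) as [VD [hD eD]].
    assert (hV : is_RInt_gen outer (at_right 0) (Rbar_locally p_infty) (minus VD VC)).
    { eapply outer_gen; [|apply (is_RInt_gen_minus _ _ _ _ hD hC)].
      intros l hl. rewrite outer_eq by exact hl. bop_ring. }
    split; [now exists (minus VD VC)|].
    rewrite (is_RInt_gen_unique (V := bop_CompleteNormedModule) _ _ hV), eC, eD. bop_ring.
Qed.
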